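(* Fix an integer $k\ge 2$. For each $n$ let $d=d_n\ge k$ be an integer and let $C=C^{(n)}$ be the copula of the i.i.d. $d_n$-dimensional vectors $\boldsymbol X_1,\dots,\boldsymbol X_n$ (the $n$-th row of a triangular array, all rows defined on a common probability space). Suppose that every $C^{(n)}$ satisfies the second-order regularity condition for $k$-variate margins (stated in the context) with this $k$ and with a constant $K=K(k)$ that does not depend on $n$ and $C^{(n)}$. If $\log d_n=o(n^{1/3})$ as $n\to\infty$, then \[ \sup_{\boldsymbol u\in W_k}\big|\mathbb C_n(\boldsymbol u)-\bar{\mathbb C}_n(\boldsymbol u)\big| = O_{\mathrm{a.s.}}\big(n^{-1/4}(\log(nd_n))^{3/4}\big)=o_{\mathrm{a.s.}}(1), \] and the implicit constant in the error bound depends only on $k$ and $K$.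
   Context: Setting. For each $n$, $\boldsymbol X_1,\dots,\boldsymbol X_n$ are i.i.d. random vectors in $\mathbb R^{d}$, $d=d_n$, $\boldsymbol X_i=(X_{i1},\dots,X_{id})$ (upper index $(n)$ suppressed), with continuous marginal cdfs $F_1,\dots,F_d$ and (unique) copula $C=C^{(n)}$. Put $U_{ij}=F_j(X_{ij})$, $\boldsymbol U_i=(U_{i1},\dots,U_{id})$; $R_{ij}$ is the (max-)rank of $X_{ij}$ among $X_{1j},\dots,X_{nj}$ and $\hat U_{ij}=R_{ij}/n$, $\hat{\boldsymbol U}_i=(\hat U_{i1},\dots,\hat U_{id})$. Inequalities between vectors are componentwise. Empirical copula: $\hat C_n(\boldsymbol u)=\frac1n\sum_{i=1}^n \mathbf 1(\hat{\boldsymbol U}_i\le \boldsymbol u)$; empirical copula process: $\mathbb C_n(\boldsymbol u)=\sqrt n\{\hat C_n(\boldsymbol u)-C(\boldsymbol u)\}$, $\boldsymbol u\in[0,1]^d$. Standard empirical process: $\alpha_n(\boldsymbol u)=n^{-1/2}\sum_{i=1}^n\{\mathbf 1(\boldsymbol U_i\le\boldsymbol u)-C(\boldsymbol u)\}$, with $j$-th margin $\alpha_{nj}(u_j)=\alpha_n(1,\dots,1,u_j,1,\dots,1)$ ($u_j$ at position $j$). Linearization: $\bar{\mathbb C}_n(\boldsymbol u)=\alpha_n(\boldsymbol u)-\sum_{j=1}^d \dot C_j(\boldsymbol u)\alpha_{nj}(u_j)$. Here $\dot C_j(\boldsymbol u)=\lim_{h\to0}\{C(\boldsymbol u+h\boldsymbol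 e_j)-C(\boldsymbol u)\}/h$ for $u_j\in(0,1)$, $\dot C_j(\boldsymbol u)=\limsup_{h\downarrow0}\{C(\boldsymbol u+h\boldsymbol e_j)-C(\boldsymbol u)\}/h$ if $u_j=0$, and $\dot C_j(\boldsymbol u)=\limsup_{h\downarrow0}\{C(\boldsymbol u-h\boldsymbol e_j)-C(\boldsymbol u)\}/(-h)$ if $u_j=1$. Since $\alpha_{nj}(1)=0$, only indices $j$ with $u_j<1$ contribute to the sum. Sets: $W_k=W_{d,k}=\{\boldsymbol u\in[0,1]^d: |\{j:u_j<1\}|\le k\}$ and $V_j=\{\boldsymbol u\in[0,1]^d:u_j\in(0,1)\}$. Second-order regularity condition for $k$-variate margins (with constant $K$), for $2\le k\le d$: for each $j\in\{1,\dots,d\}$ the first-order partial derivative $\dot C_j$ exists and is continuous on $V_j\cap W_k$; for each $i,j\in\{1,\dots,d\}$ the second-order partial derivative $\ddot C_{ij}$ exists and is continuous on $V_i\cap V_j\cap W_k$; and for all $i,j\in\{1,\dots,d\}$ and all $\boldsymbol u\in V_i\cap V_j\cap W_k$, \[|\ddot C_{ij}(\boldsymbol u)|\le K\min\Big(\frac1{u_j(1-u_j)},\frac1{u_i(1-u_i)}\Big).\] $X_n=O_{\mathrm{a.s.}}(a_n)$ means $\limsup_n |X_n|/a_n<\infty$ almost surely; $X_n=o_{\mathrm{a.s.}}(1)$ means $X_n\to0$ almost surely. *)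

(* Defs.v *)
From mathcomp Require Import all_boot all_order all_algebra.
From mathcomp Require Import all_classical all_reals all_analysis.

Set Implicit Arguments.
Unset Strict Implicit.
Unset Printing Implicit Defensive.

Import Order.TTheory GRing.Theory Num.Theory.
Import numFieldNormedType.Exports.

Local Open Scope classical_set_scope.
Local Open Scope ring_scope.

Section vectors.
Context {R : realType} {d : nat}.

Definition cube : set 'rV[R]_d := [set u | forall j, 0 <= u 0 j <= 1].

Definition W (k : nat) : set 'rV[R]_d :=
  [set u | cube u /\ (#|[pred j | (u 0 j < 1)%R]| <= k)%N].

Definition V (j : 'I_d) : set 'rV[R]_d := [set u | cube u /\ 0 < u 0 j < 1].

Definition unit_vec (j : 'I_d) : 'rV[R]_d := delta_mx 0 j.

(* (1, ..., 1, t, 1, ..., 1) with t at position j *)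
Definition ones_but (j : 'I_d) (t : R) : 'rV[R]_d :=
  \row_l (if l == j then t else 1).

End vectors.

Section copulas.
Context {R : realType} {d : nat}.
Implicit Types (Q : probability (d.-tuple R) R) (C : 'rV[R]_d -> R).

Definition joint_cdf Q (x : 'rV[R]_d) : R :=
  fine (Q [set y | forall j, tnth y j <= x 0 j]).

Definition margin_cdf Q (j : 'I_d) (t : R) : R :=
  fine (Q [set y | tnth y j <= t]).

(* The restriction to [0,1]^d of a cdf with standard uniform margins; the
   values of C outside the cube are irrelevant throughout. *)
Definition is_copula C : Prop :=
  exists Q, (forall j t, 0 <= t <= 1 -> margin_cdf Q j t = t) /\
            (forall u, cube u -> C u = joint_cdf Q u).

(* Sklar's relation; it determines C on the cube when the margins of mu are
   continuous. *)
Definition copula_of (mu : probability (d.-tuple R) R) C : Prop :=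
  is_copula C /\
  forall x, joint_cdf mu x = C (\row_j margin_cdf mu j (x 0 j)).

(* On the faces u_j = 0 and u_j = 1 the limsup replaces the derivative; the
   difference quotients of a copula lie in [0,1], so [fine] is harmless. *)
Definition pderiv C (j : 'I_d) (u : 'rV[R]_d) : R :=
  if u 0 j == 0 then
    fine (limf_esup
      (fun h : R => ((C (u + h *: unit_vec j) - C u) / h)%:E) 0^'+)
  else if u 0 j == 1 then
    fine (limf_esup
      (fun h : R => ((C (u - h *: unit_vec j) - C u) / (- h))%:E) 0^'+)
  else 'D_(unit_vec j) C u.

Definition pderiv2 C (i j : 'I_d) (u : 'rV[R]_d) : R :=
  'D_(unit_vec i) (pderiv C j) u.

Definition second_order_regular (k : nat) (K : R) C : Prop :=
  [/\ forall j,
        (forall u, (V j `&` W k) u -> derivable C u (unit_vec j)) /\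
        {within V j `&` W k, continuous (pderiv C j)},
      forall i j,
        (forall u, (V i `&` V j `&` W k) u ->
           derivable (pderiv C j) u (unit_vec i)) /\
        {within V i `&` V j `&` W k, continuous (pderiv2 C i j)} &
      forall i j u, (V i `&` V j `&` W k) u ->
        `|pderiv2 C i j u| <=
          K * Num.min (u 0 j * (1 - u 0 j))^-1 (u 0 i * (1 - u 0 i))^-1].

End copulas.

Section sampling.
Context {dT : measure_display} {T : measurableType dT} {R : realType}.
Variable P : probability T R.

Definition mutually_independent {d'} {T' : measurableType d'} {I : finType}
    (Y : I -> {RV P >-> T'}) : Prop :=
  forall (J : {set I}) (B : I -> set T'),
    (forall i, i \in J -> measurable (B i)) ->
    P (\bigcap_(i in [set` J]) (Y i @^-1` B i)) =
      (\prod_(i in J) P (Y i @^-1` B i))%E.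

Definition iid_with_law {d'} {T' : measurableType d'} {I : finType}
    (mu : probability T' R) (Y : I -> {RV P >-> T'}) : Prop :=
  mutually_independent Y /\
  forall i (A : set T'), measurable A -> distribution P (Y i) A = mu A.

(* X_n = O_as(a_n) with an explicit bound c on the limsup *)
Definition bigO_as (X : nat -> T -> \bar R) (a : nat -> R) (c : R) : Prop :=
  \forall w \ae P, (limn_esup (fun n => X n w * ((a n)^-1)%:E) <= c%:E)%E.

Definition littleo1_as (X : nat -> T -> \bar R) : Prop :=
  \forall w \ae P, X n w @[n --> \oo] --> 0%E.

End sampling.

Section processes.
Context {R : realType} {n d : nat}.
Variables (mu : probability (d.-tuple R) R) (C : 'rV[R]_d -> R).
Variable x : 'I_n -> d.-tuple R.

Definition pit (i : 'I_n) : 'rV[R]_d :=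
  \row_j margin_cdf mu j (tnth (x i) j).

(* max-rank: ties receive the largest rank *)
Definition max_rank (i : 'I_n) (j : 'I_d) : nat :=
  #|[pred l | tnth (x l) j <= tnth (x i) j]|.

Definition pseudo_obs (i : 'I_n) : 'rV[R]_d :=
  \row_j ((max_rank i j)%:R / n%:R).

Definition emp_copula (u : 'rV[R]_d) : R :=
  n%:R^-1 * \sum_(i < n) [forall j, pseudo_obs i 0 j <= u 0 j]%:R.

Definition emp_copula_process (u : 'rV[R]_d) : R :=
  Num.sqrt n%:R * (emp_copula u - C u).

Definition std_emp_process (u : 'rV[R]_d) : R :=
  (Num.sqrt n%:R)^-1 *
  \sum_(i < n) ([forall j, pit i 0 j <= u 0 j]%:R - C u).

Definition std_emp_margin (j : 'I_d) (t : R) : R :=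
  std_emp_process (ones_but j t).

Definition linearization (u : 'rV[R]_d) : R :=
  std_emp_process u - \sum_(j < d) pderiv C j u * std_emp_margin j (u 0 j).

Definition sup_error (k : nat) : \bar R :=
  ereal_sup [set (`|emp_copula_process u - linearization u|)%:E
            | u in W k].

End processes.

Definition rate {R : realType} (d : nat -> nat) (n : nat) : R :=
  n%:R `^ (- (1 / 4)) * ln (n * d n)%:R `^ (3 / 4).

(* Main.v *)
(** Write lam = log (n d) and A u for sqrt n times the standard empirical
process at u.  Replace each coordinate u_j of u in W_k by the Bahadur-type
value v_j = u_j - A_j(u_j) / n, A_j being the j-th margin of A (coordinates
within O(lam / n) of 0 or 1 are kept).  The events {rank_ij <= n u_j} and
{U_ij <= v_j} are both initial segments of the sample ordered by its j-th
coordinate, so they differ by as many indices as their cardinalities do; hence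
the empirical copula at u is, up to O(k) increments of A over distances
O(sqrt (lam / n)), the empirical cdf at v.  What remains is another such
increment and a second-order Taylor remainder of C between u and v.  The bound
on the second derivatives blows up at the faces exactly as fast as the relative
bound |A_j(t)| = O(sqrt (lam n t (1 - t))) allows.  All bounds on A come from a
Chernoff inequality for the number of sample points in a Borel set, applied to
the polynomially many differences of boxes with corners on a grid of mesh 1/n,
and the Borel-Cantelli lemma. *)

From HB Require Import structures.
Require Import Defs.
From mathcomp Require Import all_boot all_order all_algebra.
From mathcomp Require Import all_classical all_reals all_analysis.
From mathcomp Require Import zify ring lra.

Set Implicit Arguments.
Unset Strict Implicit.
Unset Printing Implicit Defensive.

Import Order.TTheory GRing.Theory Num.Theory.
Import numFieldNormedType.Exports.

Local Open Scope classical_set_scope.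
Local Open Scope ring_scope.

(** Randomness enters only through finitely many Chernoff events per n; once [good_sample] holds,
    every estimate is deterministic and pointwise in u. Uniformity in the dimension comes from this:
    d enters through the number of test sets, hence through log (n d), while each sum over the d
    coordinates costs only a factor k, because coordinates equal to 1 contribute nothing.
    Differences of boxes are tested, and not only boxes, because an increment of A has to be
    measured against the mass between the two points. This turns displacements of order sqrt (lam /
    n) into increments of order sqrt (lam * sqrt (lam * n)), which is sqrt n times the rate. The
    obstacle is the blow-up at the faces. The relative bound on A_j(t) needs n t (1 - t) to be at
    least of order lam, so coordinates closer to a face cannot be moved; their contribution is
    itself of order lam, which the error absorbs. Ties are not discarded as a null event but counted
    like the points of any thin strip. *)

Section binomial_tail.
Context {R : realType}.

Lemma measure_cover_le {dT} {T : measurableType dT} (mu : {measure set T -> \bar R})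
    (I : finType) (Q : pred I) (F : I -> set T) (A : set T) :
  measurable A -> (forall i, measurable (F i)) ->
  (forall t, A t -> exists2 i, Q i & F i t) ->
  (mu A <= \sum_(i | Q i) mu (F i))%E.
Proof.
move=> mA mF AF.
have sub : A `<=` \big[setU/set0]_(i | Q i) F i.
  move=> t /AF[i Qi Fit]; rewrite -bigcup_seq_cond.
  by exists i => //=; rewrite mem_index_enum.
apply: (@le_trans _ _ (mu (\big[setU/set0]_(i | Q i) F i))).
  by apply: le_measure; rewrite ?inE//; exact: bigsetU_measurable.
have [] // : measurable (\big[setU/set0]_(i | Q i) F i) /\
  (mu (\big[setU/set0]_(i | Q i) F i) <= \sum_(i | Q i) mu (F i))%E.
elim/big_rec2: _ => [|i y B _ [mB le]]; first by rewrite measure0.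
split; first exact: measurableU.
by apply: (le_trans (measureU2 mu (mF i) mB)); exact: leeD2l.
Qed.

(** * Chernoff bounds for the number of sample points in a set *)

Definition hits {T' : Type} {n : nat} (x : 'I_n -> T') (B : set T') : nat :=
  #|[pred i | x i \in B]|.

(** From [1 - s <= expR (- s)] follows [expR s <= 1 / (1 - s)]; the rest is
    [s ^+ 2 * (1 - 2 * s) >= 0]. Negative [s] is included for the sake of the lower tail. *)
Lemma expR_quadratic (s : R) : s <= 1 / 2 -> expR s - 1 <= s + 2 * s ^+ 2.
Proof.
move=> s2; have s1 : 0 < 1 - s by lra.
have es : expR s * (1 - s) <= 1.
  rewrite -[leRHS](expRxMexpNx_1 s) ler_wpM2l ?expR_ge0//.
  exact: expR_ge1Dx.
rewrite -(ler_pM2r s1); apply: (@le_trans _ _ (1 - (1 - s))); first by lra.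
have : 0 <= s ^+ 2 * (1 - 2 * s) by rewrite mulr_ge0 ?sqr_ge0//; lra.
by rewrite !expr2; nra.
Qed.

Context {dT : measure_display} {T : measurableType dT} (P : probability T R).
Context {d' : measure_display} {T' : measurableType d'} (mu : probability T' R).
Context {n : nat} {Y : 'I_n -> {RV P >-> T'}} (iidY : iid_with_law mu Y).
Variables (B : set T') (mB : measurable B).

Let p := fine (mu B).

Let muB : mu B = p%:E.
Proof. by rewrite /p fineK// fin_num_measure. Qed.

Let p01 : 0 <= p <= 1.
Proof.
by rewrite -!lee_fin -muB measure_ge0 probability_le1.
Qed.

(** Fixing the whole set [J] of hitting indices turns independence into a finite product, so the
    exponential moment below is a sum over subsets and involves no integral. *)
Lemma prob_pattern (J : {set 'I_n}) :
  P [set w | forall i, (Y i w \in B) = (i \in J)] =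
  (\prod_i (if i \in J then p else 1 - p))%:E.
Proof.
pose Bi i := if i \in J then B else ~` B.
have mBi i : measurable (Bi i) by rewrite /Bi; case: ifP => // _; exact: measurableC.
have := iidY.1 [set: 'I_n]%SET Bi (fun i _ => mBi i).
rewrite (_ : \bigcap_(i in _) _ =
    [set w | forall i, (Y i w \in B) = (i \in J)]); last first.
  apply/seteqP; split => w /= h i.
    have := h i (finset.in_setT i); rewrite /Bi /=; case: (i \in J) => [/mem_set//|Bw].
    by apply/negbTE/negP => /set_mem.
  move=> _; rewrite /Bi /=; have := h i; case: (i \in J) => [/set_mem//|/negbT].
  by move=> /negP nB Bw; apply: nB; exact: mem_set.
move=> ->.
rewrite -prodEFin (eq_bigl xpredT) => [|i]; last by rewrite finset.in_setT.
apply: eq_bigr => i _.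
have := iidY.2 i (Bi i) (mBi i); rewrite /distribution /pushforward /= => ->.
rewrite /Bi; case: ifP => // _.
by rewrite probability_setC// muB.
Qed.

Lemma measurable_pattern (J : {set 'I_n}) :
  measurable [set w | forall i, (Y i w \in B) = (i \in J)].
Proof.
have mY i : measurable (Y i @^-1` B).
  by rewrite -[X in measurable X]setTI; exact: measurable_funPT.
rewrite (_ : [set w | _] = \bigcap_(i in [set: 'I_n])
    ((if i \in J then Y i @^-1` B else ~` (Y i @^-1` B)) : set T)); last first.
  apply/seteqP; split => [w /= h i _|w h i /=].
    by have := h i; case: (i \in J) => [/set_mem|/negbT] //=; rewrite notin_setE.
  have := h i I; case: (i \in J) => [/mem_set//|nB].
  by apply/negbTE; rewrite notin_setE.
apply: fin_bigcap_measurable => // i _; case: ifP => _ //.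
exact: measurableC.
Qed.

Lemma measurable_hits (Q : pred nat) :
  measurable [set w | Q (hits (Y ^~ w) B)].
Proof.
rewrite (_ : [set w | _] = \big[setU/set0]_(J : {set 'I_n} | Q #|J|)
   [set w | forall i, (Y i w \in B) = (i \in J)]); last first.
  apply/seteqP; split => w; rewrite -bigcup_seq_cond /=.
    move=> Qh; exists [set i | Y i w \in B]%SET => /=.
      by rewrite mem_index_enum/= cardsE.
    by move=> i; rewrite finset.in_set.
  move=> [J /= /andP[_ QJ] h].
  rewrite /hits (_ : #|_| = #|J|)//; apply: eq_card => i.
  by rewrite inE h.
by apply: bigsetU_measurable => J _; exact: measurable_pattern.
Qed.

(** Markov's inequality with the weight [expR (s * #|J|%:R - a)], which is at least 1 on the event.
    Leaving [Q] and the sign of [s] open covers both tails. *)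
Lemma hits_chernoff (Q : pred nat) (s a : R) :
  (forall c, Q c -> a <= s * c%:R) ->
  (P [set w | Q (hits (Y ^~ w) B)] <=
   (expR (n%:R * p * (expR s - 1) - a))%:E)%E.
Proof.
move=> Qs.
have cov (w : T) : [set w | Q (hits (Y ^~ w) B)] w ->
    exists2 J : {set 'I_n}, Q #|J| & [set w | forall i, (Y i w \in B) = (i \in J)] w.
  move=> /= Qh; exists [set i | Y i w \in B]%SET; first by rewrite cardsE.
  by move=> i; rewrite finset.in_set.
apply: le_trans (measure_cover_le P (measurable_hits Q) measurable_pattern cov) _.
rewrite (eq_bigr _ (fun J _ => prob_pattern J)) sumEFin lee_fin.
apply: (@le_trans _ _ (\sum_(J : {set 'I_n}) expR (- a) *
   \prod_i (if i \in J then p * expR s else 1 - p))).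
  rewrite big_mkcond /=; apply: ler_sum => J _.
  have q0 i : 0 <= (if i \in J then p * expR s else 1 - p).
    have /andP[p0 p1] := p01.
    by case: ifP => _; [rewrite mulr_ge0// expR_ge0|rewrite subr_ge0].
  case: ifP => [/Qs le|_]; last by rewrite mulr_ge0 ?expR_ge0// prodr_ge0.
  have -> : \prod_i (if i \in J then p * expR s else 1 - p) =
     expR s ^+ #|J| * \prod_i (if i \in J then p else 1 - p).
    rewrite -prodr_const [X in _ = X * _]big_mkcond /= -big_split /=.
    by apply: eq_bigr => i _; case: ifP => _; rewrite ?mul1r// mulrC.
  rewrite mulrA ler_peMl ?prodr_ge0// => [i _|].
    by have /andP[p0 p1] := p01; case: ifP => _ //; rewrite subr_ge0.
  by rewrite -expRM_natl -expRD -[leLHS]expR0 ler_expR addrC subr_ge0 mulrC.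
rewrite -mulr_sumr.
have -> : \sum_(J : {set 'I_n}) \prod_i (if i \in J then p * expR s else 1 - p) =
    \prod_(i < n) (p * expR s + (1 - p)).
  by rewrite bigA_distr; apply: eq_bigl => J.
rewrite prodr_const card_ord expRD mulrC ler_wpM2r ?expR_ge0//.
rewrite -mulrA expRM_natl.
have /andP[p0 p1] := p01.
apply: lerXn2r; rewrite ?nnegrE ?expR_ge0//.
  by rewrite addr_ge0 ?subr_ge0// mulr_ge0 ?expR_ge0.
by apply: le_trans (expR_ge1Dx _); rewrite mulrBr mulr1; lra.
Qed.

Lemma hits_deviation (M lam nu : R) :
  0 <= M -> 0 < lam <= nu -> n%:R * p <= nu ->
  (P [set w | (2 * M + 1) * Num.sqrt (lam * nu) <=
              `|(hits (Y ^~ w) B)%:R - n%:R * p| ]%R <=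
   (2 * expR (- (M * lam)))%:E)%E.
Proof.
move=> M0 /andP[lam0 lamnu] npnu.
set r := Num.sqrt _.
have nu0 : 0 < nu by exact: lt_le_trans lamnu.
have r2 : r * r = lam * nu by rewrite -expr2 sqr_sqrtr// mulr_ge0// ltW.
have r0 : 0 < r by rewrite sqrtr_gt0 mulr_gt0.
have lamr : lam <= r.
  rewrite -[leLHS]ger0_norm ?(ltW lam0)// -sqrtr_sqr ler_wsqrtr// expr2.
  by rewrite ler_wpM2l// ltW.
(* This [s] balances the exponent: the linear term is [(M + 1 / 2) * lam] and the quadratic one at
   most [lam / 2], so [M * lam] remains. The assumption [lam <= nu] gives [s <= 1 / 2]. *)
pose s := lam / (2 * r).
have s0 : 0 <= s by rewrite divr_ge0 ?mulr_ge0 ?ltW.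
have s12 : s <= 1 / 2.
  by rewrite ler_pdivrMr ?mulr_gt0// mulrA mul1r mulVf ?mul1r// gt_eqF.
have sr : s * ((2 * M + 1) * r) = (M + 1 / 2) * lam.
  by rewrite /s; field; rewrite gt_eqF.
have np0 : 0 <= n%:R * p by rewrite mulr_ge0//; case/andP: p01.
have s2 : n%:R * p * (2 * s ^+ 2) <= lam / 2.
  apply: (@le_trans _ _ (nu * (2 * s ^+ 2))).
    by rewrite ler_wpM2r// mulr_ge0// sqr_ge0.
  rewrite le_eqVlt; apply/orP; left; apply/eqP.
  rewrite /s -(mulfK (x := r * r) _ (lam / 2)); last by rewrite mulf_neq0 ?gt_eqF.
  rewrite [in LHS]mulrC; rewrite [X in _ / 2 * X]r2; field.
  by rewrite gt_eqF.
pose Q1 (c : nat) := (2 * M + 1) * r <= c%:R - n%:R * p.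
pose Q2 (c : nat) := (2 * M + 1) * r <= n%:R * p - c%:R.
have -> : [set w | (2 * M + 1) * r <= `|(hits (Y ^~ w) B)%:R - n%:R * p|] =
    [set w | Q1 (hits (Y ^~ w) B)] `|` [set w | Q2 (hits (Y ^~ w) B)].
  apply/seteqP; split => w /=; rewrite /Q1 /Q2 ler_normr opprB.
    by case/orP; [left|right].
  by case=> ->; rewrite ?orbT.
apply: le_trans (measureU2 _ (measurable_hits Q1) (measurable_hits Q2)) _.
rewrite (_ : 2 * _ = expR (- (M * lam)) + expR (- (M * lam))); last by ring.
rewrite EFinD; apply: leeD.
- apply: le_trans (@hits_chernoff Q1 s (s * (n%:R * p + (2 * M + 1) * r)) _) _.
    by move=> c; rewrite /Q1 => h; rewrite ler_wpM2l//; lra.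
  rewrite lee_fin ler_expR [s * (_ + _)]mulrDr sr.
  by have := ler_wpM2l np0 (expR_quadratic s12); lra.
- apply: le_trans (@hits_chernoff Q2 (- s) (- s * (n%:R * p - (2 * M + 1) * r)) _) _.
    by move=> c; rewrite /Q2 => h; rewrite !mulNr lerN2 ler_wpM2l//; lra.
  rewrite lee_fin ler_expR mulNr [s * (_ - _)]mulrBr sr.
  have sN : - s <= 1 / 2 by lra.
  have := ler_wpM2l np0 (expR_quadratic sN); rewrite sqrrN; lra.
Qed.

End binomial_tail.

Lemma hits_family_deviation {R : realType} {dT} {T : measurableType dT}
    (P : probability T R) {d'} {T' : measurableType d'} (mu : probability T' R)
    {n : nat} {Y : 'I_n -> {RV P >-> T'}} {I : finType} (B : I -> set T')
    (M lam : R) (nu := fun i => Num.max (n%:R * fine (mu (B i))) lam)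
    (E := [set w | exists i, (2 * M + 1) * Num.sqrt (lam * nu i) <=
              `|(hits (Y ^~ w) (B i))%:R - n%:R * fine (mu (B i))| ]) :
  iid_with_law mu Y -> (forall i, measurable (B i)) -> 0 <= M -> 0 < lam ->
  measurable E /\ (P E <= (#|I|%:R * (2 * expR (- (M * lam))))%:E)%E.
Proof.
move=> iidY mB M0 lam0.
pose F i := [set w | (2 * M + 1) * Num.sqrt (lam * nu i) <=
              `|(hits (Y ^~ w) (B i))%:R - n%:R * fine (mu (B i))| ].
have mF i : measurable (F i).
  exact: (measurable_hits (mB i) (fun c : nat => (2 * M + 1) *
    Num.sqrt (lam * nu i) <= `|c%:R - n%:R * fine (mu (B i))|)).
have mE : measurable E.
  rewrite (_ : E = \bigcup_(i in [set: I]) F i).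
    by apply: fin_bigcup_measurable => // i _.
  by apply/seteqP; split => w [i]; [exists i|exists i].
split=> //; apply: le_trans (measure_cover_le (Q := xpredT) P mE mF _) _.
  by move=> w [i Fi]; exists i.
rewrite mulr_natl -[X in (_ *+ X)%R]sum1_card -sumrMnr -sumEFin.
apply: lee_sum => i _; rewrite mulr1n; apply: hits_deviation => //.
  by rewrite lam0 le_max lexx orbT.
by rewrite le_max lexx.
Qed.

(** * Borel-Cantelli for events with inverse-square probabilities *)

Section borel_cantelli.
Context {R : realType} {dT : measure_display} {T : measurableType dT}.
Variable P : probability T R.

Lemma sum_inv_sqr_le (n : nat) : \sum_(0 <= i < n) (i.+1%:R ^- 2 : R) <= 2.
Proof.
have [->|n0] := eqVneq n 0%N; first by rewrite big_geq.
(* The sharper bound [2 - 1 / n] is the one that induction can carry. *)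
apply: (@le_trans _ _ (2 - n%:R^-1)); last by rewrite gerBl invr_ge0.
case: n n0 => // n _; elim: n => [|n IH].
  by rewrite big_nat1 expr1n invr1; lra.
rewrite big_nat_recr//=; apply: (le_trans (lerD IH (lexx _))).
have a0 : 0 < n.+1%:R :> R by [].
have -> : n.+2%:R = n.+1%:R + 1 :> R by rewrite -natr1.
set a : R := n.+1%:R in a0 *.
rewrite -subr_ge0.
have -> : 2 - (a + 1)^-1 - (2 - a^-1 + (a + 1) ^- 2) = a^-1 * (a + 1) ^- 2.
  by field; rewrite !gt_eqF//; lra.
by rewrite mulr_ge0// invr_ge0 ?exprn_ge0//; lra.
Qed.

Lemma borel_cantelli_inv_sqr (E : nat -> set T) (c : R) (N : nat) :
  (forall n, (N <= n)%N -> measurable (E n)) ->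
  (forall n, (N <= n)%N -> (P (E n) <= (c * n%:R ^- 2)%:E)%E) ->
  \forall w \ae P, exists N', forall n, (N' <= n)%N -> ~ E n w.
Proof.
move=> mE PE.
have c0 : 0 <= c.
  have := le_trans (measure_ge0 P (E N.+1)) (PE _ (leqnSn N)).
  by rewrite lee_fin pmulr_lge0// invr_gt0 exprn_gt0.
(* Starting after [N] makes the index of [F n] at least [n.+1], which allows the comparison with
   [n.+1%:R ^- 2]. *)
pose F n := E (N + n).+1.
have NF n : (N <= (N + n).+1)%N by rewrite leqW// leq_addr.
have mF n : measurable (F n) by exact: mE.
have sF : (\sum_(n <oo) P (F n) < +oo)%E.
  apply: (@le_lt_trans _ _ (c * 2)%:E); last exact: ltry.
  apply: lime_le; first exact: is_cvg_nneseries.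
  apply: nearW => n.
  apply: (@le_trans _ _ (\sum_(0 <= i < n) (c * i.+1%:R ^- 2)%:E)%E).
    apply: lee_sum => i _; apply: le_trans (PE _ (NF i)) _.
    rewrite lee_fin ler_wpM2l// lef_pV2 ?posrE ?exprn_gt0//.
    by rewrite lerXn2r ?nnegrE// ler_nat ltnS leq_addl.
  by rewrite sumEFin lee_fin -mulr_sumr ler_wpM2l// sum_inv_sqr_le.
exists (lim_sup_set F); split.
- apply: bigcap_measurable => // k _; exact: bigcup_measurable.
- exact: lim_sup_set_cvg0.
- move=> w /= nw k _; apply: contrapT => nF; apply: nw.
  exists (N + k).+1 => n Nkn En; apply: nF.
  have e : ((N + (n.-1 - N)).+1 = n)%N by lia.
  exists (n.-1 - N)%N => /=; first by lia.
  by rewrite /F e.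
Qed.

End borel_cantelli.

(** * Lipschitz bounds for distributions with uniform margins *)

Section orthants.
Context {R : realType} {dT : measure_display} {T : measurableType dT}.
Variable Q : probability T R.
Context {d : nat} (A : 'I_d -> R -> set T).
Hypothesis mA : forall j t, measurable (A j t).
Hypothesis homoA : forall j s t, s <= t -> A j s `<=` A j t.
Hypothesis QA : forall j t, 0 <= t <= 1 -> fine (Q (A j t)) = t.

(** The family [A] is abstract because it has two instances: the coordinates under the law that
    defines the copula, and the transforms [margin_cdf mu j] under [mu]. *)
Definition orthant (u : 'rV[R]_d) : set T := [set y | forall j, A j (u 0 j) y].

Lemma measurable_orthant u : measurable (orthant u).
Proof.
rewrite (_ : orthant u = \bigcap_(j in [set: 'I_d]) A j (u 0 j)).
  by apply: fin_bigcap_measurable => // j _.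
by apply/seteqP; split => y h j //; exact: h.
Qed.

Lemma sub_orthant (u v : 'rV[R]_d) :
  (forall j, u 0 j <= v 0 j) -> orthant u `<=` orthant v.
Proof. by move=> uv y uy j; exact: homoA (uv j) _ (uy j). Qed.

(** A point of the difference violates some constraint of [u], hence lies in one of the strips
    between levels [u 0 j] and [v 0 j]; a strip is empty unless the level increases. *)
Lemma orthantD_le (u v : 'rV[R]_d) : cube u -> cube v ->
  fine (Q (orthant v `\` orthant u)) <= \sum_j Num.max (v 0 j - u 0 j) 0.
Proof.
move=> cu cv; pose F j := A j (v 0 j) `\` A j (u 0 j).
have mF j : measurable (F j) by exact: measurableD.
have mD : measurable (orthant v `\` orthant u).
  by apply: measurableD; exact: measurable_orthant.
rewrite -lee_fin fineK ?fin_num_measure// -sumEFin.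
apply: le_trans (measure_cover_le (Q := xpredT) Q mD mF _) _.
  move=> y [vy /existsNP[j nuy]]; exists j => //; split => //; exact: vy.
apply: lee_sum => j _; rewrite /F.
have [uv|/ltW vu] := leP (u 0 j) (v 0 j).
  rewrite measureD//; last by rewrite ltey_eq fin_num_measure.
  rewrite setIidr; last exact: homoA.
  rewrite -[X in (X - _)%E]fineK ?fin_num_measure//.
  rewrite -[X in (_ - X)%E]fineK ?fin_num_measure// -EFinB lee_fin !QA//.
  by rewrite le_max lexx.
rewrite (_ : _ `\` _ = set0) ?measure0 ?lee_fin ?le_max ?lexx ?orbT//.
by rewrite -subset0 => y [vy]; apply; exact: homoA vu _ vy.
Qed.

Lemma fine_orthantB (u v : 'rV[R]_d) :
  fine (Q (orthant v)) - fine (Q (orthant u)) =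
  fine (Q (orthant v `\` orthant u)) - fine (Q (orthant u `\` orthant v)).
Proof.
have mO := measurable_orthant.
have e (a b : 'rV[R]_d) : fine (Q (orthant a)) =
    fine (Q (orthant a `\` orthant b)) + fine (Q (orthant a `&` orthant b)).
  rewrite -fineD ?fin_num_measure//; [|exact: measurableD|exact: measurableI].
  rewrite measureD ?subeK ?fin_num_measure//; first exact: measurableI.
  by rewrite ltey_eq fin_num_measure.
by rewrite (e v u) (e u v) setIC; ring.
Qed.

Lemma orthant_lipschitz (u v : 'rV[R]_d) : cube u -> cube v ->
  `|fine (Q (orthant v)) - fine (Q (orthant u))| <= \sum_j `|v 0 j - u 0 j|.
Proof.
move=> cu cv.
have h (a b : 'rV[R]_d) : cube a -> cube b ->
    fine (Q (orthant b)) - fine (Q (orthant a)) <= \sum_j `|b 0 j - a 0 j|.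
  move=> ca cb; rewrite fine_orthantB lerBlDr.
  apply: (le_trans (orthantD_le ca cb)); rewrite -[leLHS]addr0; apply: lerD.
    by apply: ler_sum => j _; rewrite ge_max normr_ge0 ler_norm.
  exact: fine_ge0.
rewrite ler_norml h// andbT lerNl opprB.
by apply: le_trans (h _ _ cv cu) _; apply: ler_sum => j _; rewrite distrC.
Qed.

Lemma orthant_homo (u v : 'rV[R]_d) : (forall j, u 0 j <= v 0 j) ->
  fine (Q (orthant u)) <= fine (Q (orthant v)).
Proof.
move=> uv; have mO := measurable_orthant.
apply: fine_le; rewrite ?fin_num_measure//.
by apply: le_measure; rewrite ?inE//; exact: sub_orthant.
Qed.

End orthants.

(** * Probability integral transform and Sklar's relation *)

Section copula_facts.
Context {R : realType} {d : nat}.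
Implicit Types (Q : probability (d.-tuple R) R) (C : 'rV[R]_d -> R).

Lemma measurable_coord_le (j : 'I_d) (f : R -> R) (t : R) :
  measurable_fun setT f ->
  measurable [set y : d.-tuple R | f (tnth y j) <= t].
Proof.
move=> mf; have m := measurableT_comp mf (measurable_tnth j).
have := m measurableT _ (measurable_itv `]-oo, t]); rewrite setTI.
by congr measurable; apply/seteqP; split => y /=; rewrite in_itv.
Qed.

Lemma copula_orthant C : is_copula C -> exists Q,
  (forall j t, 0 <= t <= 1 -> fine (Q [set y : d.-tuple R | tnth y j <= t]) = t) /\
  (forall u, cube u -> C u =
     fine (Q (orthant (fun j t => [set y : d.-tuple R | tnth y j <= t]) u))).
Proof. by case=> Q [mQ CQ]; exists Q; split. Qed.

Lemma copula_lipschitz C (u v : 'rV[R]_d) : is_copula C -> cube u -> cube v ->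
  `|C v - C u| <= \sum_j `|v 0 j - u 0 j|.
Proof.
move=> /copula_orthant[Q [mQ CQ]] cu cv; rewrite !CQ//.
apply: orthant_lipschitz => // j t; first exact: (measurable_coord_le j _ (@measurable_id _ _ _)).
by move=> t' tt' y /= /le_trans; apply.
Qed.

Variables (mu : probability (d.-tuple R) R).
Hypothesis cmu : forall j, continuous (margin_cdf mu j).

Lemma measurable_margin_cdf_le j t :
  measurable [set y : d.-tuple R | margin_cdf mu j (tnth y j) <= t].
Proof.
apply: (@measurable_coord_le j (margin_cdf mu j)).
exact: measurable_realfun.continuous_measurable_fun.
Qed.

Lemma margin_cdf_homo j : {homo margin_cdf mu j : s t / s <= t}.
Proof.
move=> s t st; have m r : measurable [set y : d.-tuple R | tnth y j <= r].
  exact: (measurable_coord_le j _ (@measurable_id _ _ _)).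
apply: fine_le; rewrite ?fin_num_measure//; apply: le_measure; rewrite ?inE//.
by move=> y /= /le_trans; apply.
Qed.

Lemma margin_cdf_itv j t : 0 <= margin_cdf mu j t <= 1.
Proof.
rewrite fine_ge0//= -lee_fin fineK ?fin_num_measure//; last first.
  exact: (measurable_coord_le j _ (@measurable_id _ _ _)).
apply: probability_le1; exact: (measurable_coord_le j _ (@measurable_id _ _ _)).
Qed.

Definition coord (j : 'I_d) : d.-tuple R -> R := fun y => tnth y j.

HB.instance Definition _ (j : 'I_d) :=
  isMeasurableFun.Build _ _ _ _ (coord j) (measurable_tnth j).

Lemma margin_cdfE j :
  margin_cdf mu j = fine \o cdf (coord j : {RV mu >-> R}).
Proof.
apply/funext => t; rewrite /margin_cdf /cdf /distribution /pushforward /=.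
congr (fine (mu _)); apply/seteqP; split => y /=; rewrite in_itv//=.
Qed.

Lemma margin_cdf_onto j t : 0 < t < 1 -> exists x, margin_cdf mu j x = t.
Proof.
move=> /andP[t0 t1].
have := fine_cvg (@cvg_cdfy1 _ _ _ mu (coord j : {RV mu >-> R})).
rewrite -margin_cdfE => cvy.
have [M [_ MP]] := @cvgr_gt _ _ _ _ _ 1 (cvy _) t t1.
pose b := M + 1; have tb : t < margin_cdf mu j b by apply: MP; rewrite /b ltrDl.
have := fine_cvg (@cvg_cdfNy0 _ _ _ mu (coord j : {RV mu >-> R})).
rewrite -margin_cdfE => cvNy.
have [m [_ mP]] := @cvgr_lt _ _ _ _ _ 0 (cvNy _) t t0.
pose a := Num.min (m - 1) b.
have at' : margin_cdf mu j a < t.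
  by apply: mP; rewrite /a gt_min; apply/orP; left; lra.
have ab : a <= b by rewrite /a ge_min lexx orbT.
have [x _ <-] : exists2 c, c \in `[a, b] & margin_cdf mu j c = t.
  apply: IVT => //.
    exact/continuous_subspaceT/cmu.
  by rewrite ge_min le_max (ltW tb) (ltW at') /= orbT.
by exists x.
Qed.

(** Each level in (0, 1) is attained by the continuous cdf at some [x]. Comparing the event with the
    half-lines up to such [x], for levels below and above [t], pins its mass even if the cdf has
    flat pieces. *)
Lemma pit_margin j t : 0 <= t <= 1 ->
  fine (mu [set y : d.-tuple R | margin_cdf mu j (tnth y j) <= t]) = t.
Proof.
move=> /andP[t0 t1]; set m := fine _.
have mS := measurable_margin_cdf_le j.
have mC r : measurable [set y : d.-tuple R | tnth y j <= r].
  exact: (measurable_coord_le j _ (@measurable_id _ _ _)).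
have m01 : 0 <= m <= 1.
  rewrite /m fine_ge0//= -lee_fin fineK ?fin_num_measure//.
  exact: probability_le1.
have lo r : 0 < r < 1 -> r <= t -> r <= m.
  move=> /margin_cdf_onto - /(_ j)[x <-] xt; apply: fine_le; rewrite ?fin_num_measure//.
  apply: le_measure; rewrite ?inE// => y /= yx.
  exact: le_trans (margin_cdf_homo _ yx) xt.
have hi r : 0 < r < 1 -> t < r -> m <= r.
  move=> /margin_cdf_onto - /(_ j)[x <-] xt; apply: fine_le; rewrite ?fin_num_measure//.
  apply: le_measure; rewrite ?inE// => y /= yt; rewrite leNgt; apply/negP => xy.
  by have := le_lt_trans yt xt; rewrite ltNge margin_cdf_homo// ltW.
apply/eqP; rewrite eq_le; apply/andP; split; rewrite leNgt; apply/negP => h.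
  have := hi ((t + m) / 2); lra.
have := lo ((t + m) / 2); lra.
Qed.

Definition pit_box (u : 'rV[R]_d) : set (d.-tuple R) :=
  [set y | forall j, margin_cdf mu j (tnth y j) <= u 0 j].

Lemma pit_box_orthant u : pit_box u =
  orthant (fun j t => [set y : d.-tuple R | margin_cdf mu j (tnth y j) <= t]) u.
Proof. by []. Qed.

Lemma measurable_pit_box u : measurable (pit_box u).
Proof.
rewrite pit_box_orthant; apply: measurable_orthant => j t.
exact: measurable_margin_cdf_le.
Qed.

(** Sklar's relation concerns half-lines of the original coordinates, and on flat pieces of the
    margins these are smaller than the events in [pit_box]. Monotonicity still gives [C v <= H v],
    and [H a <= C b] when [a] is strictly below [b], at interior points; the Lipschitz bounds close
    the gap and reach the faces. *)
Lemma pit_box_copula C u : copula_of mu C -> cube u -> fine (mu (pit_box u)) = C u.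
Proof.
move=> [isC sklar] cu.
pose H u := fine (mu (pit_box u)).
have mS := measurable_margin_cdf_le.
have mC j r : measurable [set y : d.-tuple R | tnth y j <= r].
  exact: (measurable_coord_le j _ (@measurable_id _ _ _)).
have homoS (j : 'I_d) : forall s t, s <= t ->
    [set y : d.-tuple R | margin_cdf mu j (tnth y j) <= s] `<=`
    [set y : d.-tuple R | margin_cdf mu j (tnth y j) <= t].
  by move=> s t st y /= /le_trans; apply.
pose open_cube (v : 'rV[R]_d) := forall j, 0 < v 0 j < 1.
have onto v : open_cube v -> exists x : 'rV[R]_d,
    forall j, margin_cdf mu j (x 0 j) = v 0 j.
  move=> ov; have [x xP] := choice (fun j => margin_cdf_onto j (ov j)).
  by exists (\row_j x j) => j; rewrite mxE.
have CJ (v x : 'rV[R]_d) : (forall j, margin_cdf mu j (x 0 j) = v 0 j) -> C v = joint_cdf mu x.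
  by move=> xv; rewrite sklar; congr C; apply/rowP => j; rewrite mxE.
have mJ (x : 'rV[R]_d) : measurable [set y : d.-tuple R | forall j, tnth y j <= x 0 j].
  exact: (@measurable_orthant _ _ _ _ (fun j t => [set y : d.-tuple R | tnth y j <= t])).
have lo v : open_cube v -> C v <= H v.
  move=> /onto[x xv]; rewrite (CJ _ _ xv) /joint_cdf /H.
  apply: fine_le; rewrite ?fin_num_measure//; first exact: measurable_pit_box.
  apply: le_measure; rewrite ?inE//; first exact: measurable_pit_box.
  by move=> y /= yx j; rewrite -xv margin_cdf_homo.
have hi (a b : 'rV[R]_d) : open_cube b -> (forall j, a 0 j < b 0 j) -> H a <= C b.
  move=> /onto[x xv] ab; rewrite (CJ _ _ xv) /joint_cdf /H.
  apply: fine_le; rewrite ?fin_num_measure//; first exact: measurable_pit_box.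
  apply: le_measure; rewrite ?inE//; first exact: measurable_pit_box.
  move=> y /= ya j; rewrite leNgt; apply/negP => xy.
  have := le_lt_trans (ya j) (ab j); rewrite -xv ltNge margin_cdf_homo//.
  exact: ltW.
have lipH (v w : 'rV[R]_d) : cube v -> cube w -> `|H w - H v| <= \sum_j `|w 0 j - v 0 j|.
  by move=> cv cw; exact: (orthant_lipschitz mS homoS pit_margin).
have lipC (v w : 'rV[R]_d) : cube v -> cube w -> `|C w - C v| <= \sum_j `|w 0 j - v 0 j|.
  by move=> cv cw; exact: copula_lipschitz.
apply/eqP; rewrite -subr_eq0 -normr_le0; apply/ler_addgt0Pr => e e0.
pose D : R := 8 * (d%:R + 1).
have D0 : 0 < D by rewrite mulr_gt0// ltr_wpDl// ler0n.
pose h : R := Num.min (e / D) (1 / 4).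
have h0 : 0 < h by rewrite lt_min !divr_gt0.
have h4 : h <= 1 / 4 by rewrite ge_min lexx orbT.
have hD : D * h <= e.
  by rewrite mulrC -ler_pdivlMr// ge_min lexx.
(* The factor [1 - 2 * h] leaves room for the offsets, so both points are interior; they are
   strictly ordered and within [2 * h] of [u] in each coordinate. *)
pose a : 'rV[R]_d := \row_j ((1 - 2 * h) * u 0 j + h / 2).
pose b : 'rV[R]_d := \row_j ((1 - 2 * h) * u 0 j + h).
have oa : open_cube a by move=> j; rewrite mxE; have := cu j; nra.
have ob : open_cube b by move=> j; rewrite mxE; have := cu j; nra.
have ab j : a 0 j < b 0 j by rewrite !mxE; lra.
have oc v : open_cube v -> cube v.
  by move=> ov j; have /andP[? ?] := ov j; rewrite !ltW.
have near (v : 'rV[R]_d) : (forall j, `|v 0 j - u 0 j| <= 2 * h) ->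
    \sum_j `|v 0 j - u 0 j| <= d%:R * (2 * h).
  move=> vu; apply: (@le_trans _ _ (\sum_(j < d) 2 * h)); first exact: ler_sum.
  by rewrite [leRHS]mulr_natl sumr_const card_ord.
have au : \sum_j `|a 0 j - u 0 j| <= d%:R * (2 * h).
  by apply: near => j; rewrite mxE ler_norml; have := cu j; nra.
have bu : \sum_j `|b 0 j - u 0 j| <= d%:R * (2 * h).
  by apply: near => j; rewrite mxE ler_norml; have := cu j; nra.
have /ler_normlP[h1 h2] := le_trans (lipH _ _ cu (oc _ oa)) au.
have /ler_normlP[h3 h4'] := le_trans (lipC _ _ cu (oc _ oa)) au.
have /ler_normlP[h5 h6] := le_trans (lipC _ _ cu (oc _ ob)) bu.
have := lo _ oa; have := hi _ _ ob ab.
have : d%:R * (2 * h) * 4 <= e by apply: le_trans hD; rewrite /D; nra.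
rewrite add0r -/(H u) ler_norml => *; lra.
Qed.

End copula_facts.

(** * Deviation bounds and their transfer by sandwiching *)

Section deviation.
Context {R : realType} {d' : measure_display} {T' : measurableType d'}.
Variables (mu : probability T' R) (n : nat) (x : 'I_n -> T').

(* y plays the role of the variance in a Bernstein-type bound. *)
Definition deviation_le (c lam : R) (B : set T') : Prop :=
  forall y, n%:R * fine (mu B) <= y -> lam <= y ->
    `|(hits x B)%:R - n%:R * fine (mu B)| <= c * Num.sqrt (lam * y).

Lemma hits_sub (A B : set T') : A `<=` B -> (hits x A <= hits x B)%N.
Proof.
by move=> AB; apply/subset_leq_card/fintype.subsetP => i; rewrite !inE => /AB.
Qed.

Lemma fine_measure_subU3 (A B E F : set T') : measurable A -> measurable B ->
  measurable E -> measurable F -> A `<=` B `|` E `|` F ->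
  fine (mu A) <= fine (mu B) + fine (mu E) + fine (mu F).
Proof.
move=> mA mB mE mF sub.
rewrite -!fineD ?fin_num_measure//; last by rewrite fin_numD !fin_num_measure.
apply: fine_le; rewrite ?fin_numD ?fin_num_measure//.
apply: le_trans (leeD (measureU2 _ mB mE) (lexx _)).
apply: le_trans (measureU2 _ (measurableU _ _ mB mE) mF).
by apply: le_measure; rewrite ?inE//; apply: measurableU => //; exact: measurableU.
Qed.

Lemma fine_measure_sub (A B : set T') : measurable A -> measurable B ->
  A `<=` B -> fine (mu A) <= fine (mu B).
Proof.
move=> mA mB AB; apply: fine_le; rewrite ?fin_num_measure//.
by apply: le_measure; rewrite ?inE.
Qed.

(* The additive error e, at most the variance y up to a factor, is absorbed in
   the constant since 1 <= lam <= y. *)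
Lemma deviation_le_sandwich (c lam e : R) (L B H : set T') :
  0 <= c -> 1 <= lam -> 0 <= e -> L `<=` B -> B `<=` H ->
  n%:R * fine (mu H) <= n%:R * fine (mu B) + e ->
  n%:R * fine (mu B) <= n%:R * fine (mu L) + e ->
  fine (mu L) <= fine (mu B) ->
  deviation_le c lam L -> deviation_le c lam H ->
  deviation_le (c * (1 + e) + e) lam B.
Proof.
move=> c0 lam1 e0 LB BH muH muB muL devL devH y By lamy.
have y0 : 0 <= y by lra.
have ey : y + e <= (1 + e) * y by nra.
set r := Num.sqrt (lam * y).
have r1 : 1 <= r by rewrite -sqrtr1 ler_wsqrtr//; nra.
have re : Num.sqrt (lam * (y + e)) <= (1 + e) * r.
  apply: (@le_trans _ _ (Num.sqrt ((1 + e) ^+ 2 * (lam * y)))).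
    apply: ler_wsqrtr; rewrite expr2 [leRHS]mulrCA ler_wpM2l//; first lra.
    apply: (le_trans ey); rewrite -mulrA ler_wpM2l//; first lra.
    nra.
  by rewrite sqrtrM ?sqr_ge0// sqrtr_sqr ger0_norm//; lra.
have := devH (y + e); have := devL (y + e).
have nLB := hits_sub LB; have nBH := hits_sub BH.
move: nLB nBH; rewrite -!(ler_nat R) => nLB nBH.
have mLB : n%:R * fine (mu L) <= n%:R * fine (mu B) by rewrite ler_wpM2l.
rewrite !ler_norml => hL hH.
have /andP[hL1 hL2] := hL ltac:(lra) ltac:(lra).
have /andP[hH1 hH2] := hH ltac:(lra) ltac:(lra).
have ce := ler_wpM2l c0 re.
have er : e <= e * r by rewrite ler_peMr.
by apply/andP; split; lra.
Qed.

End deviation.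

(** * Grid points with at most k coordinates below 1 *)

Section grid.
Context {R : realType} {d k n : nat}.
Hypothesis n0 : (0 < n)%N.

(* Codes (coordinate, level) for the at most k coordinates below 1, so that
   there are only polynomially many of them in n and d. *)
Definition grid_code := {ffun 'I_k -> 'I_d * 'I_n.+1}.

(** Coordinates named by no code get the default 1. If a coordinate is named twice, [pick] selects
    one of its levels. *)
Definition grid_point (g : grid_code) : 'rV[R]_d :=
  \row_j if [pick m | (g m).1 == j] is Some m then (g m).2%:R / n%:R else 1.

Lemma grid_point_onto (a : 'I_d -> 'I_n.+1) (j0 : 'I_d) :
  (#|[pred j | a j != n :> nat]| <= k)%N ->
  exists g, grid_point g = \row_j ((a j)%:R / n%:R).
Proof.
set J := [pred j | _] => Jk.
(* If fewer than [k] coordinates lie below 1, [nth] pads with [j0]; its level is again taken from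
   [a], so the padding changes nothing. *)
pose g : grid_code := [ffun m : 'I_k => (nth j0 (enum J) m, a (nth j0 (enum J) m))].
have gE m : g m = ((g m).1, a (g m).1) by rewrite !ffunE.
exists g; apply/rowP => j; rewrite !mxE.
case: pickP => [m /eqP <-|nog]; first by rewrite {1}gE.
have -> : a j = n :> nat.
  apply/eqP/negPn/negP => jJ.
  have jin : j \in enum J by rewrite mem_enum.
  have lt : (index j (enum J) < k)%N.
    by apply: leq_trans Jk; rewrite cardE index_mem.
  by have := nog (Ordinal lt); rewrite ffunE /= nth_index// eqxx.
by rewrite divff// pnatr_eq0 -lt0n.
Qed.

(** The error has to vanish at coordinates equal to 1, or it would be summed over [d] coordinates
    and not over [k]; hence the indicator in the bounds and the cap [minn (t j).+1 n] in the upper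
    point. *)
Lemma W_grid_bracket (u : 'rV[R]_d) (j0 : 'I_d) : W k u ->
  exists gl gh, forall j,
    [/\ 0 <= grid_point gl 0 j <= u 0 j, u 0 j <= grid_point gh 0 j <= 1,
        u 0 j - grid_point gl 0 j <= (u 0 j < 1)%R%:R / n%:R &
        grid_point gh 0 j - u 0 j <= (u 0 j < 1)%R%:R / n%:R].
Proof.
move=> [cu uk]; have nR : 0 < n%:R :> R by rewrite ltr0n.
pose t j := Num.truncn (n%:R * u 0 j).
have tP j : (t j)%:R <= n%:R * u 0 j < (t j).+1%:R.
  by apply: truncn_itv; have /andP[? _] := cu j; rewrite mulr_ge0// ltW.
have tn j : (t j <= n)%N.
  rewrite -(ler_nat R); have /andP[h _] := tP j; apply: le_trans h _.
  by have /andP[_ ?] := cu j; rewrite ler_piMr// ltW.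
have t1 j : u 0 j = 1 -> t j = n.
  move=> uj; apply/eqP; rewrite eqn_leq tn /= -ltnS -(ltr_nat R).
  by have /andP[_] := tP j; rewrite uj mulr1.
have le1 j : u 0 j < 1 \/ u 0 j = 1.
  have /andP[_] := cu j; rewrite le_eqVlt => /orP[/eqP|]; by [right|left].
have lt1 j : ~~ (u 0 j < 1) -> u 0 j = 1 by case: (le1 j) => // ->.
have tS j : (minn (t j).+1 n < n.+1)%N by rewrite ltnS geq_minr.
have tL j : (t j < n.+1)%N by rewrite ltnS.
have [|gl glE] := @grid_point_onto (fun j => Ordinal (tL j)) j0.
  apply: leq_trans uk; apply/subset_leq_card/fintype.subsetP => j; rewrite !inE /=.
  by apply: contraR => /lt1/t1 ->.
have [|gh ghE] := @grid_point_onto (fun j => Ordinal (tS j)) j0.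
  apply: leq_trans uk; apply/subset_leq_card/fintype.subsetP => j; rewrite !inE /=.
  by apply: contraR => /lt1/t1 ->; rewrite (minn_idPr _).
exists gl, gh => j; rewrite glE ghE !mxE /=.
have /andP[u0 u1] := cu j; have /andP[ta tb] := tP j.
have [uj|uj] := le1 j; last first.
  rewrite uj ltxx mul0r t1// (minn_idPr _)// divff ?gt_eqF// subrr.
  by rewrite ler01 lexx.
have tn' : (t j < n)%N.
  by rewrite -(ltr_nat R); apply: le_lt_trans ta _; rewrite gtr_pMr.
rewrite uj (minn_idPl _)// mul1r.
rewrite divr_ge0// ler_pdivrMr// [_ * n%:R]mulrC ta.
rewrite ler_pdivlMr// [u 0 j * _]mulrC (ltW tb) ler_pdivrMr// mul1r ler_nat tn'.
split=> //.
  rewrite lerBlDr (_ : _ + _ = (t j).+1%:R / n%:R); last first.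
    by rewrite -natr1 mulrDl mul1r addrC.
  by rewrite ler_pdivlMr// mulrC ltW.
rewrite lerBlDr ler_pdivrMr// mulrDl mulVf ?gt_eqF// [_ * n%:R]mulrC -natr1.
by rewrite addrC lerD2l.
Qed.

End grid.

(** * From grid boxes to all boxes with corners in [W k] *)

Section good_sample.
Context {R : realType} {d : nat} (mu : probability (d.-tuple R) R).
Hypothesis cmu : forall j, continuous (margin_cdf mu j).
Context {k n : nat}.
Hypotheses (n0 : (0 < n)%N) (d0 : (0 < d)%N).

Definition test_set (i : option (@grid_code d k n) * (@grid_code d k n)) : set (d.-tuple R) :=
  if i.1 is Some g then pit_box mu (grid_point i.2) `\` pit_box mu (grid_point g)
  else pit_box mu (grid_point i.2).

Lemma measurable_test_set i : measurable (test_set i).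
Proof.
case: i => -[g|] h /=; last exact: measurable_pit_box.
by apply: measurableD; exact: measurable_pit_box.
Qed.

Definition good_sample (c lam : R) (x : 'I_n -> d.-tuple R) : Prop :=
  forall v, W k v -> deviation_le mu x c lam (pit_box mu v) /\
    forall u, W k u -> deviation_le mu x c lam (pit_box mu v `\` pit_box mu u).

Lemma sum_support_le (u : 'rV[R]_d) (f : 'I_d -> R) : W k u ->
  (forall j, f j <= (u 0 j < 1)%R%:R / n%:R) ->
  n%:R * \sum_j Num.max (f j) 0 <= k%:R.
Proof.
move=> [_ uk] fu; have nR : 0 < n%:R :> R by rewrite ltr0n.
rewrite mulr_sumr; apply: (@le_trans _ _ (\sum_j (u 0 j < 1)%R%:R)).
  apply: ler_sum => j _; rewrite mulrC -ler_pdivlMr// ge_max fu.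
  by rewrite divr_ge0.
by rewrite -natr_sum ler_nat -big_mkcond sum1_card in uk *.
Qed.

Lemma pit_boxD_le (u v : 'rV[R]_d) : cube u -> cube v ->
  fine (mu (pit_box mu v `\` pit_box mu u)) <= \sum_j Num.max (v 0 j - u 0 j) 0.
Proof.
move=> cu cv; rewrite !pit_box_orthant; apply: orthantD_le => //.
- by move=> j t; exact: measurable_margin_cdf_le.
- by move=> j s t st y /= /le_trans; apply.
- exact: pit_margin.
Qed.

Lemma sub_pit_box (u v : 'rV[R]_d) : (forall j, u 0 j <= v 0 j) ->
  pit_box mu u `<=` pit_box mu v.
Proof. by move=> uv y uy j; exact: le_trans (uy j) (uv j). Qed.

(** Bracketing one box by grid boxes costs mass at most [k / n] on either side. A difference
    involves two boxes, whence the error [2 * k%:R] in [deviation_le_sandwich] and the resulting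
    constant. *)
Lemma grid_good_sample (c lam : R) (x : 'I_n -> d.-tuple R) :
  0 <= c -> 1 <= lam ->
  (forall i, `|(hits x (test_set i))%:R - n%:R * fine (mu (test_set i))| <=
     c * Num.sqrt (lam * Num.max (n%:R * fine (mu (test_set i))) lam)) ->
  good_sample (c * (1 + 2 * k%:R) + 2 * k%:R) lam x.
Proof.
move=> c0 lam1 test.
have dev i : deviation_le mu x c lam (test_set i).
  move=> y By lamy; apply: (le_trans (test i)); rewrite ler_wpM2l// ler_wsqrtr//.
  by rewrite ler_wpM2l ?(le_trans ler01)// ge_max By.
have k2 : 0 <= 2 * k%:R :> R by rewrite mulr_ge0.
have nR : 0 <= n%:R :> R by [].
have mb := measurable_pit_box cmu.
have mbD a b : measurable (pit_box mu a `\` pit_box mu b) by exact: measurableD.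
have bracket (u : 'rV[R]_d) : W k u -> exists gl gh : @grid_code d k n,
    [/\ pit_box mu (grid_point gl) `<=` pit_box mu u,
        pit_box mu u `<=` pit_box mu (grid_point gh),
        n%:R * fine (mu (pit_box mu u `\` pit_box mu (grid_point gl))) <= k%:R &
        n%:R * fine (mu (pit_box mu (grid_point gh) `\` pit_box mu u)) <= k%:R].
  move=> Wu; have [gl [gh gP]] := W_grid_bracket n0 (Ordinal d0) Wu.
  have cu := Wu.1.
  have cl : cube (grid_point gl : 'rV[R]_d).
    move=> j; have [/andP[? h1] _ _ _] := gP j; have /andP[_ h2] := cu j.
    by rewrite (le_trans h1)// andbT.
  have ch : cube (grid_point gh : 'rV[R]_d).
    by move=> j; have [_ /andP[h1 ?] _ _] := gP j; have /andP[h2 _] := cu j; rewrite (le_trans h2).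
  exists gl, gh; split.
  - by apply: sub_pit_box => j; have [/andP[]] := gP j.
  - by apply: sub_pit_box => j; have [_ /andP[]] := gP j.
  - apply: le_trans (ler_wpM2l nR (pit_boxD_le cl cu)) _.
    by apply: sum_support_le Wu _ => j; have [] := gP j.
  - apply: le_trans (ler_wpM2l nR (pit_boxD_le cu ch)) _.
    by apply: sum_support_le Wu _ => j; have [] := gP j.
have split2 (A B E F : set (d.-tuple R)) : measurable A -> measurable B ->
    measurable E -> measurable F -> A `<=` B `|` E `|` F ->
    n%:R * fine (mu E) <= k%:R -> n%:R * fine (mu F) <= k%:R ->
    n%:R * fine (mu A) <= n%:R * fine (mu B) + 2 * k%:R.
  move=> mA mB mE mF sub nE nF.
  by have := ler_wpM2l nR (fine_measure_subU3 mu mA mB mE mF sub); lra.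
have sub1 (A B : set (d.-tuple R)) : A `<=` B `|` (A `\` B) `|` (A `\` B).
  by move=> y Ay; have [By|nBy] := pselect (B y); [left; left|right].
move=> v /bracket[vl [vh [vlv vvh nvl nvh]]]; split.
  apply: (deviation_le_sandwich c0 lam1 k2 vlv vvh).
  - exact: (split2 _ _ _ _ _ _ _ _ _ nvh nvh).
  - exact: (split2 _ _ _ _ _ _ _ _ _ nvl nvl).
  - exact: fine_measure_sub.
  - exact: dev (None, vl).
  - exact: dev (None, vh).
move=> u /bracket[ul [uh [ulu uuh nul nuh]]].
have sub2 (A B C D : set (d.-tuple R)) : A `\` B `<=` (C `\` D) `|` (A `\` C) `|` (D `\` B).
  move=> y [Ay nBy]; have [Cy|nCy] := pselect (C y); last by left; right.
  by have [Dy|nDy] := pselect (D y); [right|left; left].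
have subD (A B C D : set (d.-tuple R)) : A `<=` C -> D `<=` B -> A `\` B `<=` C `\` D.
  by move=> sAC sDB y [Ay nBy]; split; [exact: sAC|move=> /sDB].
(* The subtracted box is bracketed the other way round: [vl] minus [uh] from inside, [vh] minus [ul]
   from outside. *)
apply: (deviation_le_sandwich c0 lam1 k2 (subD _ _ _ _ vlv uuh) (subD _ _ _ _ vvh ulu)).
- exact: (split2 _ _ _ _ _ _ _ _ _ nvh nul).
- exact: (split2 _ _ _ _ _ _ _ _ _ nvl nuh).
- by apply: fine_measure_sub => //; exact: subD.
- exact: dev (Some uh, vl).
- exact: dev (Some ul, vh).
Qed.

End good_sample.

(** * Mean value and Taylor bounds along coordinate paths *)

Section directional_mvt.
Context {R : realType} {d : nat}.
Implicit Types (f : 'rV[R]_d -> R) (u v w : 'rV[R]_d).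

Definition between u v w : Prop :=
  forall l, Num.min (u 0 l) (v 0 l) <= w 0 l <= Num.max (u 0 l) (v 0 l).

Lemma is_derive_line f w (e : 'rV[R]_d) (t : R) :
  derivable f (w + t *: e) e ->
  is_derive t 1 (fun s => f (w + s *: e)) ('D_e f (w + t *: e)).
Proof.
have eq : (fun h : R => h^-1 *: ((fun s => f (w + s *: e)) (h *: 1 + t) - f (w + t *: e))) =
    (fun h => h^-1 *: (f (h *: e + (w + t *: e)) - f (w + t *: e))).
  by apply/funext => h /=; rewrite addrCA -scalerDl [h *: 1]mulr1.
by move=> df; split; rewrite /derivable /derive eq.
Qed.

(* Allowing the slope a in the remainder gives the second-order bound from two
   first-order ones in copula_taylor, without multivariate calculus. *)
Lemma line_mvt f w (j : 'I_d) (s a B : R) :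
  (forall t, Num.min 0 s <= t <= Num.max 0 s ->
     derivable f (w + t *: unit_vec j) (unit_vec j) /\
     `|'D_(unit_vec j) f (w + t *: unit_vec j) - a| * `|s| <= B) ->
  `|f (w + s *: unit_vec j) - f w - a * s| <= B.
Proof.
move=> h.
pose phi t := f (w + t *: unit_vec j).
pose dphi t := 'D_(unit_vec j) f (w + t *: unit_vec j).
have dP t : Num.min 0 s <= t <= Num.max 0 s -> is_derive t 1 phi (dphi t).
  by move=> /h[? _]; exact: is_derive_line.
have [c cs e] : exists2 c, Num.min 0 s <= c <= Num.max 0 s &
    phi s - phi 0 = dphi c * s.
  have mM : Num.min 0 s <= Num.max 0 s by rewrite ge_min le_max lexx.
  have [|||c cI e] := @MVT_segment R phi dphi (Num.min 0 s) (Num.max 0 s).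
  - exact: mM.
  - by move=> t; rewrite in_itv/= => /andP[t1 t2]; apply: dP; rewrite !ltW.
  - apply: derivable_within_continuous => t; rewrite in_itv/= => /dP dt.
    exact: ex_derive.
  move: cI; rewrite in_itv/= => cI; exists c => //.
  have [s0|/ltW s0] := leP 0 s.
    by move: e; rewrite (max_idPr s0) (min_idPl s0) subr0.
  by move: e; rewrite (max_idPl s0) (min_idPr s0) => e; rewrite -opprB e; ring.
have [_] := h c cs; rewrite -normrM; congr (`|_| <= _).
by rewrite mulrBl -/(dphi c) -e /phi scale0r addr0.
Qed.

(** Changing one coordinate at a time telescopes [f v - f u] into line increments. Only axis
    derivatives in the directions that move are used, so the bound applies on [W k], which has empty
    interior for [k < d]. *)
Lemma path_mvt f u v (a B : 'I_d -> R) :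
  (forall i w, between u v w -> u 0 i != v 0 i ->
     derivable f w (unit_vec i) /\
     `|'D_(unit_vec i) f w - a i| * `|v 0 i - u 0 i| <= B i) ->
  `|f v - f u - \sum_i a i * (v 0 i - u 0 i)| <= \sum_(i | u 0 i != v 0 i) B i.
Proof.
move=> h.
pose p (m : nat) : 'rV[R]_d := \row_l (if (l < m)%N then v 0 l else u 0 l).
have p0 : p 0%N = u by apply/rowP => l; rewrite mxE.
have pd : p d = v by apply/rowP => l; rewrite mxE ltn_ord.
have pS (i : 'I_d) : p i.+1 = p i + (v 0 i - u 0 i) *: unit_vec i.
  apply/rowP => l; rewrite !mxE eqxx /= ltnS.
  have [->|li] := eqVneq l i; first by rewrite leqnn ltnn /=; ring.
  by rewrite leq_eqVlt (inj_eq val_inj) (negbTE li) /= mulr0 addr0.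
have -> : f v - f u = \sum_(i < d) (f (p i.+1) - f (p i)).
  by rewrite -(big_mkord xpredT (fun i => f (p i.+1) - f (p i))) telescope_sumr// pd p0.
rewrite -sumrB.
rewrite [leRHS]big_mkcond /=.
apply: le_trans (ler_norm_sum _ _ _) _; apply: ler_sum => i _.
have [ui|ui] := eqVneq (u 0 i) (v 0 i).
  by rewrite pS ui subrr scale0r addr0 !subrr mulr0 subrr normr0.
rewrite pS; apply: line_mvt => t tI; apply: h => // l.
rewrite !mxE eqxx /=; have [->|li] := eqVneq l i; last first.
  rewrite mulr0 addr0; case: ifP => _.
    by rewrite ge_min le_max !lexx !orbT.
  by rewrite ge_min le_max !lexx.
rewrite ltnn /= mulr1.
have [uv|/ltW uv] := leP (u 0 i) (v 0 i).
  move: tI; have s0 : 0 <= v 0 i - u 0 i by rewrite subr_ge0.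
  by rewrite (min_idPl s0) (max_idPr s0); lra.
move: tI; have s0 : v 0 i - u 0 i <= 0 by rewrite subr_le0.
by rewrite (min_idPr s0) (max_idPl s0); lra.
Qed.

(** A coordinate that moves lies below 1 in [u], so at most [k] of them move and the box spanned by
    [u] and [v] stays in [W k]. Each of the two passes of [path_mvt], for [C] and for its first
    derivatives, costs a factor [k]. *)
Lemma copula_taylor (k : nat) (K B : R) (C : 'rV[R]_d -> R) u v :
  second_order_regular k K C -> W k u -> 0 <= B ->
  (forall j, u 0 j != v 0 j -> 0 < u 0 j < 1 /\ 0 < v 0 j < 1) ->
  (forall i j w, between u v w -> u 0 i != v 0 i -> u 0 j != v 0 j ->
     K * Num.min (w 0 j * (1 - w 0 j))^-1 (w 0 i * (1 - w 0 i))^-1 *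
       (`|v 0 i - u 0 i| * `|v 0 j - u 0 j|) <= B) ->
  `|C v - C u - \sum_(j | u 0 j != v 0 j) pderiv C j u * (v 0 j - u 0 j)| <=
  k%:R ^+ 2 * B.
Proof.
move=> [Creg1 Creg2 Creg3] Wu B0 uv01 small.
have bt_eq w l : between u v w -> u 0 l = v 0 l -> w 0 l = u 0 l.
  move=> /(_ l) bw e; apply/eqP; rewrite eq_le.
  by move: bw; rewrite -e minxx maxxx andbC.
have W_bt w : between u v w -> W k w.
  move=> bw; split.
    move=> l; have [e|ne] := eqVneq (u 0 l) (v 0 l); first by rewrite bt_eq//; exact: Wu.1.
    by have := bw l; have := uv01 l ne; rewrite ge_min le_max; lra.
  apply: leq_trans Wu.2; apply/subset_leq_card/fintype.subsetP => l.
  rewrite !inE => wl; have [e|ne] := eqVneq (u 0 l) (v 0 l); first by rewrite -(bt_eq w).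
  by have [/andP[]] := uv01 l ne.
have V_bt w j : between u v w -> u 0 j != v 0 j -> V j w.
  move=> bw ne; split; first exact: (W_bt _ bw).1.
  by have := bw j; have := uv01 j ne; rewrite ge_min le_max; lra.
have pdE w j : between u v w -> u 0 j != v 0 j -> 'D_(unit_vec j) C w = pderiv C j w.
  move=> bw ne; have [_ /andP[w0 w1]] := V_bt _ _ bw ne.
  by rewrite /pderiv gt_eqF// lt_eqF.
have bt_u : between u v u by move=> l; rewrite ge_min le_max !lexx.
have card_le w : between u v w -> (#|[pred i | (u 0 i != w 0 i)%R]| <= k)%N.
  move=> bw; apply: leq_trans Wu.2; apply/subset_leq_card/fintype.subsetP => l.
  rewrite !inE => ne; have {}ne : u 0 l != v 0 l.
    by apply: contra ne => /eqP e; rewrite (bt_eq w).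
  by have [/andP[]] := uv01 l ne.
have bt_v : between u v v by move=> l; rewrite ge_min le_max !lexx !orbT.
pose a j := if u 0 j != v 0 j then pderiv C j u else 0.
rewrite [X in _ - X]big_mkcond /=.
rewrite (eq_bigr (fun j => a j * (v 0 j - u 0 j))); last first.
  by move=> j _; rewrite /a; case: ifP => // _; rewrite mul0r.
apply: le_trans (path_mvt (B := fun=> k%:R * B) _) _; last first.
  by rewrite sumr_const -[_ *+ #|_|]mulr_natl expr2 -mulrA ler_wpM2r ?mulr_ge0// ler_nat card_le.
move=> m w bw nem; split; first by apply: (Creg1 m).1; split; [exact: V_bt|exact: W_bt].
rewrite pdE// /a nem.
have D0 : 0 < `|v 0 m - u 0 m| by rewrite normr_gt0 subr_eq0 eq_sym.
rewrite -ler_pdivlMr//.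
(* The inner pass has slopes 0 and bounds the oscillation of the derivative; dividing [B] by the
   displacement compensates the factor that the outer pass puts in front. *)
have -> : pderiv C m w - pderiv C m u =
    pderiv C m w - pderiv C m u - \sum_i (fun=> 0) i * (w 0 i - u 0 i).
  by rewrite big1 ?subr0// => i _; rewrite mul0r.
apply: le_trans (path_mvt (B := fun=> B / `|v 0 m - u 0 m|) _) _; last first.
  by rewrite sumr_const -[_ *+ #|_|]mulr_natl -mulrA ler_wpM2r ?divr_ge0// ler_nat card_le.
move=> i x bx nei.
have bx' : between u v x.
  move=> l; have := bx l; have := bw l.
  by case: (leP (u 0 l) (v 0 l)) => uv; case: (leP (u 0 l) (w 0 l)) => uw; lra.
have nei' : u 0 i != v 0 i.
  by apply: contra nei => /eqP e; rewrite (bt_eq w).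
have Vi := V_bt _ _ bx' nei'; have Vm := V_bt _ _ bx' nem; have Wx := W_bt _ bx'.
split; first by apply: (Creg2 i m).1.
rewrite subr0 ler_pdivlMr// -mulrA.
apply: le_trans (small i m x bx' nei' nem).
apply: ler_pM; rewrite ?mulr_ge0//; first exact: Creg3.
rewrite ler_wpM2r//.
have := bw i; have [uv|/ltW uv] := leP (u 0 i) (v 0 i) => bwi.
  by rewrite !ger0_norm; lra.
by rewrite !ler0_norm; lra.
Qed.

End directional_mvt.

(** * Counting indices by rank *)

Section ranks.
Context {R : realType} {n : nat} (f : 'I_n -> R).

(** The counted element with the largest [f] has rank at least the count, whence the upper bound.
    The smallest element left out has rank above [s], and everything strictly below it is counted,
    so at most its ties are missing. *)
Lemma card_low_ranks (s tau : R) : 0 <= s <= n%:R -> 0 <= tau ->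
  (forall i, #|[pred l | f l == f i]|%:R <= tau) ->
  s - tau <= #|[pred i | #|[pred l | f l <= f i]|%:R <= s]|%:R <= s.
Proof.
move=> /andP[s0 sn] tau0 ties; set S := [pred i | _].
apply/andP; split; last first.
  have [i iS|S0] := pickP S; last by rewrite (eq_card0 S0).
  case: (@arg_maxP _ _ _ i S f iS) => m mS mmax.
  have : S m by []; rewrite /S /=; apply: le_trans.
  by rewrite ler_nat; apply/subset_leq_card/fintype.subsetP => l lS; exact: mmax.
have [i iS|Sall] := pickP (predC S); last first.
  rewrite (_ : #|S| = n); first lra.
  rewrite -[RHS]card_ord; apply: eq_card => i; have := Sall i; rewrite !inE /=.
  by move/negbFE.
case: (@arg_minP _ _ _ i (predC S) f iS) => m mS mmin.
have : ~~ S m by []; rewrite /S /= -ltNge => sm.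
rewrite lerBlDr; apply: (le_trans (ltW sm)).
apply: (@le_trans _ _ (#|S|%:R + #|[pred l | f l == f m]|%:R)); last first.
  by rewrite lerD2l.
rewrite -natrD ler_nat -cardUI; apply: (leq_trans _ (leq_addr _ _)).
apply/subset_leq_card/fintype.subsetP => l; rewrite !inE => lm.
apply/negPn/negP; rewrite negb_or => /andP[lS lne].
have := mmin l lS; rewrite leNgt lt_neqAle lne /=.
by move: lm; rewrite /= => ->.
Qed.

Lemma down_sets_diff (S D : pred 'I_n) :
  (forall i l, S i -> f l <= f i -> S l) ->
  (forall i l, D i -> f l <= f i -> D l) ->
  \sum_i `|(S i)%:R - (D i)%:R : R| = `|#|S|%:R - #|D|%:R : R|.
Proof.
move=> Sdown Ddown.
have cardE (Q : pred 'I_n) : #|Q|%:R = \sum_i (Q i)%:R :> R.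
  by rewrite -sum1_card natr_sum big_mkcond; apply: eq_bigr => i _; rewrite unfold_in; case: (Q i).
have nested (Q Q' : pred 'I_n) : (forall i, Q i -> Q' i) ->
    \sum_i `|(Q i)%:R - (Q' i)%:R : R| = `|#|Q|%:R - #|Q'|%:R : R|.
  move=> QQ'; rewrite !cardE -sumrB [RHS]ler0_norm.
    rewrite -sumrN; apply: eq_bigr => i _; rewrite ler0_norm// subr_le0 ler_nat.
    by have := QQ' i; case: (Q i) => // ->.
  rewrite sumr_le0// => i _; rewrite subr_le0 ler_nat.
  by have := QQ' i; case: (Q i) => // ->.
have [/forallP SD|/forallPn[i]] := boolP [forall i, S i ==> D i].
  by apply: nested => i; apply/implyP.
rewrite negb_imply => /andP[Si nDi].
under eq_bigr do rewrite distrC; rewrite distrC.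
apply: nested => l Dl; have [il|/ltW li] := leP (f i) (f l).
  by case/negP: nDi; exact: Ddown Dl il.
exact: Sdown Si li.
Qed.

Lemma forallb_diff {d : nat} (a b : 'I_d -> bool) :
  `|[forall j, a j]%:R - [forall j, b j]%:R : R| <= \sum_j `|(a j)%:R - (b j)%:R|.
Proof.
have [e|] := eqVneq [forall j, a j] [forall j, b j].
  by rewrite e subrr normr0 sumr_ge0.
move=> ne; have [j neab] : exists j, a j != b j.
  apply/existsP; apply: contraNT ne => /existsPn h; apply/eqP/eq_forallb => j.
  by apply/eqP/negPn.
rewrite (bigD1 j)//=.
have -> : `|(a j)%:R - (b j)%:R : R| = 1.
  by move: neab; case: (a j); case: (b j) => // _; rewrite ?sub0r ?subr0 ?normrN normr1.
apply: (@le_trans _ _ 1); last by rewrite lerDl sumr_ge0.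
by do 2 case: [forall _, _]; rewrite /= ?subrr ?sub0r ?subr0 ?normrN ?normr0 ?normr1.
Qed.

End ranks.

(** * Bounds on the first partial derivatives of a copula *)

Section copula_pderiv.
Context {R : realType} {d : nat}.

Lemma limf_esup_itv {T : choiceType} {X : filteredType T} (f : X -> \bar R)
    (F : set_system X) (a b : R) : ProperFilter F ->
  (\forall x \near F, (a%:E <= f x <= b%:E)%E) ->
  a <= fine (limf_esup f F) <= b.
Proof.
move=> PF Fab.
have lb : (a%:E <= limf_esup f F)%E.
  apply: le_ereal_inf_tmp => _ [V FV <-].
  have [x [Vx /andP[ax _]]] := filter_ex (filterI FV Fab).
  by apply: le_trans ax _; apply: ereal_sup_ubound; exists x.
have ub : (limf_esup f F <= b%:E)%E.
  apply: ge_ereal_inf.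
  exists (ereal_sup (f @` [set x | (a%:E <= f x <= b%:E)%E])).
    by exists [set x | (a%:E <= f x <= b%:E)%E].
  by apply: ge_ereal_sup => _ [x /= /andP[_ ?] <-].
move: lb ub; case: limf_esup => //= r; by rewrite !lee_fin => -> ->.
Qed.

Lemma copula_quotient_le (C : 'rV[R]_d -> R) (j : 'I_d) (u : 'rV[R]_d) (h : R) :
  is_copula C -> cube u -> 0 <= u 0 j + h <= 1 ->
  `|C (u + h *: unit_vec j) - C u| <= `|h|.
Proof.
move=> isC cu uh.
apply: le_trans (copula_lipschitz isC cu _) _.
  move=> l; rewrite !mxE eqxx /=; have [->|_] := eqVneq l j; first by rewrite mulr1.
  by rewrite mulr0 addr0.
rewrite (bigD1 j)//= big1 => [|l lj]; rewrite !mxE eqxx /= ?eqxx ?(negbTE lj).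
  by rewrite mulr1 addr0 [u 0 j + h]addrC addrK.
by rewrite mulr0 addr0 subrr normr0.
Qed.

(** Lipschitz continuity bounds every difference quotient by 1. The face [u 0 j = 0] has to be
    covered, because coordinates there are not shifted and their term in the linearization is
    estimated directly. *)
Lemma pderiv_le1 (C : 'rV[R]_d -> R) (j : 'I_d) (u : 'rV[R]_d) :
  is_copula C -> cube u -> u 0 j < 1 ->
  (0 < u 0 j -> derivable C u (unit_vec j)) -> `|pderiv C j u| <= 1.
Proof.
move=> isC cu u1 der; rewrite /pderiv.
have [u0|u0] := eqVneq (u 0 j) 0.
  rewrite ler_norml; apply: limf_esup_itv.
  near=> h; rewrite !lee_fin -ler_norml.
  have h0 : 0 < h by [].
  rewrite normrM normfV ler_pdivrMr ?normr_gt0 ?gt_eqF// mul1r.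
  apply: copula_quotient_le => //; rewrite u0 add0r ltW//=.
  near: h; exact: nbhs_right_le.
rewrite lt_eqF//.
have {u0} u0 : 0 < u 0 j by rewrite lt_neqAle eq_sym u0; case/andP: (cu j).
have cv := der u0.
have bd : \forall h \near (0 : R)^',
    `|h^-1 *: (C (h *: unit_vec j + u) - C u)| <= 1.
  near=> h.
  have h0 : h != 0 by near: h; exact: nbhs_dnbhs_neq.
  rewrite normrM normfV mulrC ler_pdivrMr ?normr_gt0// mul1r [h *: _ + u]addrC.
  apply: copula_quotient_le => //.
  have : `|h| < Num.min (u 0 j) (1 - u 0 j).
    near: h; apply: dnbhs0_lt; rewrite lt_min u0 subr_gt0 u1//.
  by rewrite lt_min !ltr_norml; lra.
rewrite ler_norml; apply/andP; split.
  apply: limr_ge => //; apply: filterS bd => h; by rewrite ler_norml => /andP[].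
apply: limr_le => //; apply: filterS bd => h; by rewrite ler_norml => /andP[].
Unshelve. all: by end_near. Qed.

End copula_pderiv.

Lemma hitsB {R : realType} {T' : Type} {n : nat} (x : 'I_n -> T') (A B : set T') :
  (hits x A)%:R - (hits x B)%:R =
  (hits x (A `\` B))%:R - (hits x (B `\` A))%:R :> R.
Proof.
have split2 (E F : set T') : hits x E = (hits x (E `\` F) + hits x (E `&` F))%N.
  rewrite /hits -cardUI [X in (_ + X)%N]eq_card0 => [|i].
    rewrite addn0; apply: eq_card => i; rewrite !inE; apply/idP/orP.
      move=> /set_mem Ei; have [Fi|nFi] := pselect (F (x i)).
        by right; apply/mem_set.
      by left; apply/mem_set.
    by move=> [] /set_mem[? _]; apply/mem_set.
  rewrite !inE; apply/negP => /andP[/set_mem[_ nF] /set_mem[_ F']].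
  exact: nF.
by rewrite (split2 A B) (split2 B A) setIC !natrD; ring.
Qed.

(** * The deterministic error bound on a good sample *)

Section linearization_error.
Context {R : realType} {d k n : nat} (mu : probability (d.-tuple R) R).
Hypothesis cmu : forall j, continuous (margin_cdf mu j).
Variables (C : 'rV[R]_d -> R) (K : R).
Hypotheses (copC : copula_of mu C) (regC : second_order_regular k K C).
Variables (x : 'I_n -> d.-tuple R) (c lam : R).
Hypotheses (k0 : (0 < k)%N) (n0 : (0 < n)%N).
Hypotheses (c1 : 1 <= c) (lam1 : 1 <= lam) (lamn : lam <= n%:R).
Hypothesis good : good_sample mu (k := k) c lam x.

(** By [std_emp_processE] this is sqrt n times [std_emp_process]; without the normalization it
    compares directly with numbers of indices. *)
Definition centered_hits (u : 'rV[R]_d) : R :=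
  (hits x (pit_box mu u))%:R - n%:R * C u.

Local Notation A := centered_hits.

Let nR : 0 < n%:R :> R. Proof. by rewrite ltr0n. Qed.

Lemma std_emp_processE u : std_emp_process mu C x u = (Num.sqrt n%:R)^-1 * A u.
Proof.
rewrite /std_emp_process; congr (_ * _).
rewrite sumrB sumr_const card_ord -[C u *+ n]mulr_natl; congr (_ - _).
rewrite /hits -sum1_card natr_sum [RHS]big_mkcond /=; apply: eq_bigr => i _.
have -> : [forall j, pit mu x i 0 j <= u 0 j] = (x i \in pit_box mu u).
  apply/forallP/idP => [h|/set_mem h j]; last by rewrite mxE.
  by apply/mem_set => j; have := h j; rewrite mxE.
by rewrite unfold_in; case: (x i \in _).
Qed.

Lemma centered_hits_fine u : cube u ->
  A u = (hits x (pit_box mu u))%:R - n%:R * fine (mu (pit_box mu u)).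
Proof. by move=> cu; rewrite (pit_box_copula cmu copC cu). Qed.

Lemma pit_box_ones_but j t y : t <= 1 ->
  pit_box mu (ones_but j t) y <-> margin_cdf mu j (tnth y j) <= t.
Proof.
move=> t1; split=> [/(_ j)|h l]; rewrite mxE ?eqxx//.
by case: eqVneq => [->//|_]; have /andP[] := margin_cdf_itv mu l (tnth y l).
Qed.

Lemma cube_ones_but (j : 'I_d) (t : R) : 0 <= t <= 1 -> cube (ones_but j t).
Proof. by move=> t01 l; rewrite mxE; case: ifP => // _; rewrite ler01 lexx. Qed.

Lemma W_ones_but (j : 'I_d) (t : R) : 0 <= t <= 1 -> W k (ones_but j t).
Proof.
move=> t01; split; first exact: cube_ones_but.
apply: leq_trans k0; apply: (@leq_trans #|pred1 j|); last by rewrite card1.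
apply/subset_leq_card/fintype.subsetP => l.
by rewrite !inE mxE; case: eqP => //; rewrite ltxx.
Qed.

Lemma measure_ones_but (j : 'I_d) (t : R) : 0 <= t <= 1 ->
  fine (mu (pit_box mu (ones_but j t))) = t.
Proof.
move=> t01; rewrite -[RHS](pit_margin cmu j t01); congr (fine (mu _)).
have /andP[_ t1] := t01.
by apply/seteqP; split => y /=; rewrite pit_box_ones_but.
Qed.

(** For [t] near 1 the small variance is that of the complement, which is again a difference of two
    boxes: level 1 minus level [t]. *)
Lemma margin_deviation (j : 'I_d) (t y : R) : 0 <= t <= 1 ->
  n%:R * Num.min t (1 - t) <= y -> lam <= y ->
  `|A (ones_but j t)| <= c * Num.sqrt (lam * y).
Proof.
move=> t01 ty lamy; rewrite (centered_hits_fine (cube_ones_but j t01)).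
have Wt := W_ones_but j t01.
move: ty; have [tt|/ltW tt] := leP t (1 - t) => ty.
  by apply: (good Wt).1 => //; rewrite measure_ones_but.
have i11 : 0 <= (1 : R) <= 1 by rewrite ler01 lexx.
have W1 := W_ones_but j i11.
have full : pit_box mu (ones_but j 1) = setT.
  apply/seteqP; split => // z _; rewrite pit_box_ones_but//.
  by have /andP[] := margin_cdf_itv mu j (tnth z j).
have mB := measurable_pit_box cmu (ones_but j t).
have := (good W1).2 _ Wt y; rewrite full setTD.
rewrite probability_setC//.
rewrite -[X in fine (1 - X)%E]fineK ?fin_num_measure// measure_ones_but//= => /(_ ty lamy).
have -> : (hits x (~` pit_box mu (ones_but j t)))%:R =
    n%:R - (hits x (pit_box mu (ones_but j t)))%:R :> R.
  apply/eqP; rewrite eq_sym subr_eq -natrD eqr_nat addnC; apply/eqP.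
  rewrite -[LHS](card_ord n) -(cardC [pred i | x i \in pit_box mu (ones_but j t)]).
  congr addn; apply: eq_card => i; rewrite !inE; apply/negP/idP.
    by move=> h; apply/mem_set => /mem_set.
  by move=> /set_mem h /set_mem.
by rewrite -normrN; congr (`|_| <= _); ring.
Qed.

(** The boxes need not be nested, so the increment splits into the centered counts of the two
    one-sided differences. Each has mass at most the l1 distance, whence the factor 2. *)
Lemma centered_hits_increment (u v : 'rV[R]_d) (y : R) : W k u -> W k v ->
  n%:R * \sum_j `|v 0 j - u 0 j| <= y -> lam <= y ->
  `|A v - A u| <= 2 * (c * Num.sqrt (lam * y)).
Proof.
move=> Wu Wv sy lamy; have [cu _] := Wu; have [cv _] := Wv.
rewrite !centered_hits_fine//.
have le (a b : 'rV[R]_d) : cube a -> cube b ->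
    n%:R * \sum_j `|b 0 j - a 0 j| <= y ->
    n%:R * fine (mu (pit_box mu b `\` pit_box mu a)) <= y.
  move=> ca cb; apply: le_trans; rewrite ler_wpM2l// ?(ltW nR)//.
  apply: (le_trans (pit_boxD_le cmu ca cb)).
  by apply: ler_sum => j _; rewrite ge_max normr_ge0 ler_norm.
have h1 := (good Wv).2 _ Wu y (le _ _ cu cv sy) lamy.
have sy' : n%:R * \sum_j `|u 0 j - v 0 j| <= y.
  by under eq_bigr do rewrite distrC.
have h2 := (good Wu).2 _ Wv y (le _ _ cv cu sy') lamy.
have e1 := hitsB (R := R) x (pit_box mu v) (pit_box mu u).
have e2 : fine (mu (pit_box mu v)) - fine (mu (pit_box mu u)) =
    fine (mu (pit_box mu v `\` pit_box mu u)) -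
    fine (mu (pit_box mu u `\` pit_box mu v)).
  rewrite !pit_box_orthant; apply: fine_orthantB => j t.
  exact: measurable_margin_cdf_le.
rewrite [leRHS]mulr_natl mulr2n; apply: le_trans _ (lerD h1 h2).
apply: le_trans _ (ler_normB _ _); rewrite le_eqVlt; apply/orP; left; apply/eqP.
congr (`|_|).
set a := hits _ _ in e1 *; set b := hits _ _ in e1 *.
rewrite (_ : a%:R - _ - _ = (a%:R - b%:R) - n%:R *
  (fine (mu (pit_box mu v)) - fine (mu (pit_box mu u)))); last by ring.
by rewrite e1 e2; ring.
Qed.

(** Tied observations share the level [t], so they lie in a strip of mass at most [1 / n] ending at
    [t]; the deviation bound with variance [lam] limits their number. *)
Lemma ties_le (j : 'I_d) (i : 'I_n) :
  #|[pred l | tnth (x l) j == tnth (x i) j]|%:R <= 1 + c * lam :> R.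
Proof.
pose t := margin_cdf mu j (tnth (x i) j).
have /andP[t0 t1] := margin_cdf_itv mu j (tnth (x i) j).
have lam0 : 0 <= lam by exact: le_trans lam1.
have sl : Num.sqrt (lam * lam) = lam by rewrite -expr2 sqrtr_sqr ger0_norm.
suff [B [dB muB BP]] : exists B, [/\ deviation_le mu x c lam B,
    n%:R * fine (mu B) <= 1 &
    forall y, margin_cdf mu j (tnth y j) = t -> B y].
  have := dB lam (le_trans muB lam1) (lexx _); rewrite sl ler_norml => /andP[_ h].
  apply: (@le_trans _ _ (hits x B)%:R); last first.
    by move: h; rewrite lerBlDr addrC => /le_trans; apply; rewrite lerD2r.
  rewrite ler_nat; apply/subset_leq_card/fintype.subsetP => l; rewrite !inE => /eqP e.
  by apply: BP; rewrite e.
have t01 : 0 <= t <= 1 by rewrite t0.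
have [tn|nt] := leP (n%:R * t) 1.
  exists (pit_box mu (ones_but j t)); split; first exact: (good (W_ones_but j t01)).1.
    by rewrite measure_ones_but.
  by move=> y e; rewrite pit_box_ones_but// e.
pose s := t - n%:R^-1.
have ninv : 0 < n%:R^-1 :> R by rewrite invr_gt0.
have s0 : 0 <= s by rewrite subr_ge0 -[leLHS]mulr1 ler_pdivrMl// ltW.
have s01 : 0 <= s <= 1 by rewrite s0 /s; lra.
exists (pit_box mu (ones_but j t) `\` pit_box mu (ones_but j s)); split.
- exact: (good (W_ones_but j t01)).2 (W_ones_but j s01).
- apply: le_trans (ler_wpM2l (ltW nR)
    (pit_boxD_le cmu (cube_ones_but j s01) (cube_ones_but j t01))) _.
  rewrite (bigD1 j)//= big1 => [|l /negbTE lj]; last by rewrite !mxE lj subrr maxxx.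
  rewrite !mxE eqxx addr0 opprB addrCA subrr addr0.
  by rewrite (max_idPl (ltW ninv)) mulfV// gt_eqF.
- move=> y e; split; first by rewrite pit_box_ones_but// e.
  rewrite pit_box_ones_but//; last by rewrite /s; lra.
  by rewrite e /s => h; lra.
Qed.

Implicit Types (u : 'rV[R]_d) (j : 'I_d).

(** [sigma / n] is the order of the shifts and [rho] that of the increments of [A] over such
    distances; by [sqrt_rate], [rho] is sqrt n times [rate]. *)
Local Notation sigma := (Num.sqrt (lam * n%:R)).
Local Notation rho := (Num.sqrt (lam * sigma)).

Let c0 : 0 < c. Proof. exact: lt_le_trans ltr01 c1. Qed.
Let lam0 : 0 < lam. Proof. exact: lt_le_trans ltr01 lam1. Qed.

Let lam_sigma : lam <= sigma.
Proof.
rewrite -[leLHS]ger0_norm ?(ltW lam0)// -sqrtr_sqr ler_wsqrtr// expr2.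
by rewrite ler_wpM2l// ltW.
Qed.

Let lam_rho : lam <= rho.
Proof.
rewrite -[leLHS]ger0_norm ?(ltW lam0)// -sqrtr_sqr ler_wsqrtr// expr2.
by rewrite ler_wpM2l// ltW.
Qed.

Definition edge_dist (u : 'rV[R]_d) (j : 'I_d) : R := Num.min (u 0 j) (1 - u 0 j).

(* The threshold makes |A (ones_but j (u 0 j))| <= n * edge_dist u j / 2 off the
   edges, so that shifted coordinates keep a comparable distance to 0 and 1. *)
Definition near_edge (u : 'rV[R]_d) (j : 'I_d) : bool :=
  n%:R * edge_dist u j < 4 * c ^+ 2 * lam.

(* n * shift u 0 j + A (ones_but j (u 0 j)) = n * u 0 j off the edges. *)
Definition shift (u : 'rV[R]_d) : 'rV[R]_d :=
  \row_j if near_edge u j then u 0 j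
         else u 0 j - A (ones_but j (u 0 j)) / n%:R.

Lemma shift_neq u j : u 0 j != shift u 0 j -> ~~ near_edge u j.
Proof. by rewrite mxE; case: ifP => //; rewrite eqxx. Qed.

Lemma near_edge_deviation u j : cube u -> near_edge u j ->
  `|A (ones_but j (u 0 j))| <= 2 * c ^+ 2 * lam.
Proof.
move=> cu ej; have := margin_deviation (y := 4 * c ^+ 2 * lam) j (cu j) (ltW ej).
have -> : lam * (4 * c ^+ 2 * lam) = (2 * c * lam) ^+ 2 by ring.
have cl : 0 <= 2 * c * lam by rewrite !mulr_ge0// ltW.
rewrite sqrtr_sqr (ger0_norm cl) => h.
apply: (le_trans (h _)); last by rewrite le_eqVlt; apply/orP; left; apply/eqP; ring.
rewrite ler_peMl ?(ltW c0) ?(ltW lam0) ?(ltW nR)//; have := c1; rewrite expr2; nra.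
Qed.

Lemma edge_dist_gt0 u j : ~~ near_edge u j -> 0 < edge_dist u j.
Proof.
rewrite /near_edge -leNgt => h; rewrite -(pmulr_rgt0 _ nR).
by apply: lt_le_trans h; rewrite !mulr_gt0// exprn_gt0.
Qed.

Lemma shiftE u j : ~~ near_edge u j ->
  A (ones_but j (u 0 j)) = - (n%:R * (shift u 0 j - u 0 j)).
Proof.
move=> /negbTE e; rewrite mxE e addrC addKr mulrN opprK mulrCA mulfV ?mulr1//.
by rewrite gt_eqF.
Qed.

(** Off the edges [n%:R * edge_dist u j] is at least [lam] and can serve as the variance. The
    squared form lets products of two shifts be bounded without roots. *)
Lemma shift_sqr_le u j : cube u -> ~~ near_edge u j ->
  n%:R * (shift u 0 j - u 0 j) ^+ 2 <= c ^+ 2 * lam * edge_dist u j.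
Proof.
move=> cu ej; have e0 := edge_dist_gt0 ej.
have := margin_deviation j (cu j) (lexx _).
rewrite shiftE// normrN.
set D := shift u 0 j - u 0 j; rewrite -/(edge_dist u j).
have y0 : 0 <= lam * (n%:R * edge_dist u j) by rewrite !mulr_ge0
  ?(ltW c0) ?(ltW lam0) ?(ltW nR) ?(ltW e0).
have lamy : lam <= n%:R * edge_dist u j.
  move: ej; rewrite /near_edge -leNgt; apply: le_trans.
  by rewrite ler_peMl
    ?(ltW c0) ?(ltW lam0) ?(ltW nR) ?(ltW e0)//; have := c1; rewrite expr2; nra.
move=> /(_ lamy); rewrite -(ler_pXn2r (n := 2))// ?nnegrE ?normr_ge0//; last first.
  by rewrite mulr_ge0 ?(ltW c0) ?(ltW lam0) ?(ltW nR) ?(ltW e0)// sqrtr_ge0.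
rewrite exprMn sqr_sqrtr// -normrX ger0_norm ?sqr_ge0// exprMn => h.
rewrite -(ler_pM2l nR); apply: le_trans (_ : _ <= c ^+ 2 * (lam * (n%:R * edge_dist u j))) _.
  by rewrite (_ : n%:R * (n%:R * D ^+ 2) = n%:R ^+ 2 * D ^+ 2)//; ring.
by rewrite le_eqVlt; apply/orP; left; apply/eqP; ring.
Qed.

Lemma shift_le_half u j : cube u -> ~~ near_edge u j ->
  `|shift u 0 j - u 0 j| <= edge_dist u j / 2.
Proof.
move=> cu ej; have e0 := edge_dist_gt0 ej.
have := shift_sqr_le cu ej; move: ej; rewrite /near_edge -leNgt.
set D := shift u 0 j - u 0 j; set e := edge_dist u j in e0 * => ej De.
rewrite -(ler_pXn2r (n := 2))// ?nnegrE ?normr_ge0 ?divr_ge0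
  ?(ltW c0) ?(ltW lam0) ?(ltW nR) ?(ltW e0)//.
rewrite -normrX ger0_norm ?sqr_ge0//.
rewrite -(ler_pM2l nR); apply: (le_trans De).
have := ler_wpM2r (ltW e0) ej; rewrite expr_div_n; lra.
Qed.

Lemma shift_dist_le u j : cube u ->
  n%:R * `|shift u 0 j - u 0 j| <= (u 0 j < 1)%R%:R * (c * sigma).
Proof.
move=> cu; have [ej|ej] := boolP (near_edge u j).
  by rewrite mxE ej subrr normr0 mulr0 !mulr_ge0//
    ?(ltW c0) ?(ltW lam0) ?(ltW nR) ?(ltW e0)// sqrtr_ge0.
have e0 := edge_dist_gt0 ej.
have u1 : u 0 j < 1 by move: e0; rewrite lt_min subr_gt0 => /andP[].
have e1 : edge_dist u j <= 1 by rewrite ge_min ltW.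
rewrite u1 mul1r -(ler_pXn2r (n := 2))// ?nnegrE ?mulr_ge0 ?sqrtr_ge0
  ?(ltW c0) ?(ltW lam0) ?(ltW nR) ?(ltW e0)//.
rewrite !exprMn -normrX [`|_ ^+ 2|]ger0_norm ?sqr_ge0// sqr_sqrtr ?mulr_ge0
  ?(ltW c0) ?(ltW lam0) ?(ltW nR) ?(ltW e0)//.
rewrite expr2 -mulrA; apply: le_trans (ler_wpM2l (ltW nR) (shift_sqr_le cu ej)) _.
rewrite mulrC [lam * _]mulrC mulrA -[leRHS]mulr1 -!mulrA.
have cl : 0 <= c ^+ 2 * lam by rewrite mulr_ge0 ?exprn_ge0 ?(ltW c0) ?(ltW lam0).
have := ler_wpM2l (mulr_ge0 cl (ltW nR)) e1; lra.
Qed.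

Lemma W_shift u : W k u -> W k (shift u).
Proof.
move=> Wu; have [cu uk] := Wu; split.
  move=> j; have [ej|ej] := boolP (near_edge u j); first by rewrite mxE ej.
  have := shift_le_half cu ej; rewrite ler_norml /edge_dist.
  by have := cu j; case: (leP (u 0 j) (1 - u 0 j)) => h; lra.
apply: leq_trans uk; apply/subset_leq_card/fintype.subsetP => j; rewrite !inE.
have [ej|/edge_dist_gt0] := boolP (near_edge u j); first by rewrite mxE ej.
by rewrite lt_min subr_gt0 => /andP[].
Qed.

Lemma shift_sum_le u : W k u ->
  n%:R * \sum_j `|shift u 0 j - u 0 j| <= k%:R * c * sigma.
Proof.
move=> [cu uk]; rewrite mulr_sumr.
apply: (@le_trans _ _ (\sum_j (u 0 j < 1)%R%:R * (c * sigma))).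
  by apply: ler_sum => j _; exact: shift_dist_le.
rewrite -mulr_suml -mulrA ler_wpM2r//; first by rewrite mulr_ge0 ?sqrtr_ge0// ltW.
by rewrite -natr_sum ler_nat -big_mkcond sum1_card in uk *.
Qed.

Let kc1 : 1 <= k%:R * c.
Proof.
have : 1 <= k%:R :> R by rewrite ler1n.
by have := c1; nra.
Qed.

Let sqrt_kc : 2 * (c * Num.sqrt (lam * (k%:R * c * sigma))) <= 2 * k%:R * c ^+ 2 * rho.
Proof.
have le : Num.sqrt (lam * (k%:R * c * sigma)) <= k%:R * c * rho.
  have kc0 : 0 <= k%:R * c by exact: le_trans kc1.
  rewrite -{2}(ger0_norm kc0) -sqrtr_sqr -sqrtrM ?sqr_ge0// ler_wsqrtr//.
  rewrite mulrCA expr2 -mulrA ler_wpM2l// -[leLHS]mul1r ler_wpM2r//.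
  by rewrite mulr_ge0 ?sqrtr_ge0// ltW.
have := ler_wpM2l (ltW c0) le; rewrite expr2; lra.
Qed.

Let lam_kc_sigma : lam <= k%:R * c * sigma.
Proof. by apply: (le_trans lam_sigma); rewrite ler_peMl// sqrtr_ge0. Qed.

Lemma shift_increment u : W k u -> `|A (shift u) - A u| <= 2 * k%:R * c ^+ 2 * rho.
Proof.
move=> Wu; apply: le_trans sqrt_kc.
apply: centered_hits_increment => //; first exact: W_shift.
exact: shift_sum_le.
Qed.

Lemma shift_margin_increment u j : W k u ->
  `|A (ones_but j (shift u 0 j)) - A (ones_but j (u 0 j))| <= 2 * k%:R * c ^+ 2 * rho.
Proof.
move=> Wu; apply: le_trans sqrt_kc.
apply: centered_hits_increment => //.
- by apply: W_ones_but; have [] := Wu.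
- by apply: W_ones_but; have [] := W_shift Wu.
rewrite (bigD1 j)//= big1 => [|l /negbTE lj]; last by rewrite !mxE lj subrr normr0.
rewrite !mxE !eqxx addr0 -[X in X <= _](_ : n%:R * `|shift u 0 j - u 0 j| = _); last by rewrite mxE.
apply: (le_trans (shift_dist_le j Wu.1)); rewrite mulrA.
rewrite ler_wpM2r ?sqrtr_ge0// ler_wpM2r ?(ltW c0) ?(ltW lam0) ?(ltW nR)// ler_nat.
by case: (_ < _).
Qed.

Lemma copula_ones_but j (t : R) : 0 <= t <= 1 -> C (ones_but j t) = t.
Proof.
move=> t01; rewrite -(pit_box_copula cmu copC (cube_ones_but j t01)).
exact: measure_ones_but.
Qed.

(** The rank event holds for [n * u_j] indices up to ties, the other one for [n * v_j + A_j(v_j)]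
    indices, with [v] the shifted point. By the choice of the shift, [n * v_j + A_j(u_j) = n * u_j]
    off the edges, so one increment of [A] is left; near the edges [v_j = u_j] and [A_j] itself is
    of order [lam]. *)
Lemma rank_shift_diff u j : W k u ->
  \sum_i `|(pseudo_obs x i 0 j <= u 0 j)%R%:R -
           (pit mu x i 0 j <= shift u 0 j)%R%:R : R| <=
  1 + c * lam + (2 * c ^+ 2 * lam + 2 * k%:R * c ^+ 2 * rho).
Proof.
move=> Wu; have [cu _] := Wu; have [cv _] := W_shift Wu.
pose f i := tnth (x i) j.
pose S : pred 'I_n := [pred i | pseudo_obs x i 0 j <= u 0 j].
pose D : pred 'I_n := [pred i | pit mu x i 0 j <= shift u 0 j].
have SE i : S i = ((#|[pred l | f l <= f i]|)%:R <= n%:R * u 0 j).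
  by rewrite /S /= mxE /max_rank ler_pdivrMr// mulrC.
rewrite (@down_sets_diff _ _ f S D); first last.
- by move=> i l; rewrite /D /= !mxE => Di fli; apply: le_trans Di; exact: margin_cdf_homo.
- move=> i l; rewrite !SE => Si fli; apply: le_trans Si; rewrite ler_nat.
  apply/subset_leq_card/fintype.subsetP => l'; rewrite !inE => /le_trans; exact.
have tau0 : 0 <= 1 + c * lam by rewrite addr_ge0// mulr_ge0 ?ltW.
have nu : 0 <= n%:R * u 0 j <= n%:R.
  have /andP[u0 u1] := cu j; rewrite mulr_ge0 ?ler_piMr//; exact: ltW.
have := card_low_ranks nu tau0 (ties_le j).
rewrite (_ : #|[pred i | _]| = #|S|); last by apply: eq_card => i; rewrite unfold_in -SE.
have DE : #|D|%:R = A (ones_but j (shift u 0 j)) + n%:R * shift u 0 j.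
  rewrite /centered_hits (copula_ones_but j (cv j)) subrK; congr (_%:R).
  have /andP[_ v1] := cv j; apply: eq_card => i; rewrite !unfold_in /= [pit _ _ _ _ _]mxE.
  apply/idP/idP => [h|/set_mem]; last by rewrite pit_box_ones_but.
  by apply/mem_set; rewrite pit_box_ones_but.
rewrite DE => /andP[S1 S2].
have [ej|ej] := boolP (near_edge u j).
  have := near_edge_deviation cu ej.
  have r0 : 0 <= 2 * k%:R * c ^+ 2 * rho.
    by rewrite mulr_ge0 ?sqrtr_ge0// mulr_ge0 ?sqr_ge0.
  have -> : shift u 0 j = u 0 j by rewrite mxE ej.
  rewrite !ler_norml => /andP[h1 h2]; lra.
have := shift_margin_increment j Wu; have := shiftE ej.
have l0 : 0 <= 2 * c ^+ 2 * lam by rewrite !mulr_ge0 ?sqr_ge0// ltW.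
rewrite !ler_norml => h /andP[h1 h2]; lra.
Qed.

Lemma emp_copula_shift_diff u : W k u ->
  `|\sum_(i < n) [forall j, pseudo_obs x i 0 j <= u 0 j]%:R -
    (hits x (pit_box mu (shift u)))%:R| <=
  k%:R * (1 + c * lam + (2 * c ^+ 2 * lam + 2 * k%:R * c ^+ 2 * rho)).
Proof.
move=> Wu; have [cu uk] := Wu.
set b := 1 + _ + _.
have -> : (hits x (pit_box mu (shift u)))%:R =
    \sum_i [forall j, pit mu x i 0 j <= shift u 0 j]%:R :> R.
  rewrite /hits -sum1_card natr_sum big_mkcond /=; apply: eq_bigr => i _.
  rewrite unfold_in /=; have -> : [forall j, pit mu x i 0 j <= shift u 0 j] =
      (x i \in pit_box mu (shift u)).
    apply/forallP/idP => [h|/set_mem h j]; last by rewrite mxE.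
    by apply/mem_set => j; have := h j; rewrite mxE.
  by case: (x i \in _).
rewrite -sumrB; apply: le_trans (ler_norm_sum _ _ _) _.
apply: (@le_trans _ _ (\sum_(i < n) \sum_j
   `|(pseudo_obs x i 0 j <= u 0 j)%R%:R - (pit mu x i 0 j <= shift u 0 j)%R%:R : R|)).
  by apply: ler_sum => i _; exact: forallb_diff.
rewrite exchange_big /=.
apply: (@le_trans _ _ (\sum_j (u 0 j < 1)%R%:R * b)); last first.
  have b0 : 0 <= b by rewrite !addr_ge0 ?mulr_ge0 ?sqrtr_ge0 ?exprn_ge0// ltW.
  rewrite -mulr_suml ler_wpM2r// -natr_sum ler_nat.
  by rewrite -big_mkcond sum1_card in uk *.
apply: ler_sum => j _; have [u1|u1] := boolP (u 0 j < 1).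
  by rewrite mul1r; exact: rank_shift_diff.
(* At level 1 both indicators are constantly 1, which is why the total costs a factor [k] and not
   [d]. *)
have {}u1 : u 0 j = 1.
  by have /andP[_] := cu j; rewrite le_eqVlt (negbTE u1) orbF => /eqP.
have ej : near_edge u j.
  rewrite /near_edge /edge_dist u1 subrr (min_idPr ler01) mulr0.
  by rewrite !mulr_gt0 ?exprn_gt0.
rewrite mul0r big1// => i _.
rewrite [in X in _ - X]mxE [in X in _ - X]mxE ej u1.
have -> : pseudo_obs x i 0 j <= 1.
  rewrite mxE ler_pdivrMr// mul1r ler_nat.
  by apply: leq_trans (max_card _) _; rewrite card_ord.
have /andP[_ ->] := margin_cdf_itv mu j (tnth (x i) j).
by rewrite subrr normr0.
Qed.

(** Between [u] and its shift, [w (1 - w)] stays above a quarter of the edge distance, so the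
    singular factor cancels against the product of two shifts and the remainder is of order
    [lam / n]. *)
Lemma copula_shift_taylor u : W k u ->
  n%:R * `|C (shift u) - C u -
     \sum_(j | u 0 j != shift u 0 j) pderiv C j u * (shift u 0 j - u 0 j)| <=
  4 * `|K| * c ^+ 2 * k%:R ^+ 2 * lam.
Proof.
move=> Wu; have [cu uk] := Wu.
pose B := 4 * `|K| * c ^+ 2 * lam / n%:R.
have B0 : 0 <= B by rewrite divr_ge0 ?(ltW nR)// !mulr_ge0 ?sqr_ge0// ltW.
have edge01 j : u 0 j != shift u 0 j -> 0 < u 0 j < 1 /\ 0 < shift u 0 j < 1.
  move=> /shift_neq ej; have := shift_le_half cu ej; have := edge_dist_gt0 ej.
  rewrite ler_norml /edge_dist.
  by case: (leP (u 0 j) (1 - u 0 j)) => h *; split; lra.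
have small i j w : between u (shift u) w -> u 0 i != shift u 0 i ->
    u 0 j != shift u 0 j ->
    K * Num.min (w 0 j * (1 - w 0 j))^-1 (w 0 i * (1 - w 0 i))^-1 *
       (`|shift u 0 i - u 0 i| * `|shift u 0 j - u 0 j|) <= B.
  move=> bw ni nj.
  have inv_le l : u 0 l != shift u 0 l ->
      0 < (w 0 l * (1 - w 0 l))^-1 <= 4 / edge_dist u l.
    move=> /shift_neq el; have e0 := edge_dist_gt0 el.
    have := shift_le_half cu el; have := bw l.
    have wl : edge_dist u l / 2 <= w 0 l /\ edge_dist u l / 2 <= 1 - w 0 l.
      move: (shift_le_half cu el) (bw l); rewrite ler_norml /edge_dist.
      by case: (leP (u 0 l) (1 - u 0 l)) => h; case: (leP (u 0 l) (shift u 0 l)) => h' *;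
        split; lra.
    have ww : edge_dist u l / 4 <= w 0 l * (1 - w 0 l).
      case: wl => w1 w2; set e := edge_dist u l in e0 w1 w2 *.
      have [h|h] := leP (w 0 l) (1 / 2).
        have : 0 <= (w 0 l - e / 2) * (1 - w 0 l) by rewrite mulr_ge0 ?subr_ge0//; lra.
        have : 0 <= e * (1 / 2 - w 0 l) by rewrite mulr_ge0 ?subr_ge0// ltW.
        nra.
      have : 0 <= (1 - w 0 l - e / 2) * w 0 l by rewrite mulr_ge0 ?subr_ge0//; lra.
      have : 0 <= e * (w 0 l - 1 / 2) by rewrite mulr_ge0 ?subr_ge0// ltW.
      nra.
    have w0 : 0 < w 0 l * (1 - w 0 l) by apply: lt_le_trans ww; rewrite divr_gt0.
    move=> _ _; rewrite invr_gt0 w0 /= -[4 / _]invrK lef_pV2 ?posrE ?invr_gt0 ?divr_gt0//.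
    by rewrite invf_div.
  have prod_le M : edge_dist u i <= M -> edge_dist u j <= M ->
      n%:R * (`|shift u 0 i - u 0 i| * `|shift u 0 j - u 0 j|) <= c ^+ 2 * lam * M.
    move=> iM jM.
    have cl : 0 <= c ^+ 2 * lam by rewrite mulr_ge0 ?sqr_ge0// ltW.
    have si := le_trans (shift_sqr_le cu (shift_neq ni)) (ler_wpM2l cl iM).
    have sj := le_trans (shift_sqr_le cu (shift_neq nj)) (ler_wpM2l cl jM).
    move: si sj; rewrite -[X in n%:R * X <= _]ger0_norm ?sqr_ge0//.
    rewrite -[X in _ -> n%:R * X <= _ -> _]ger0_norm ?sqr_ge0// !normrX.
    set a := `|shift u 0 i - u 0 i|; set b := `|shift u 0 j - u 0 j| => si sj.
    have : 0 <= n%:R * (a - b) ^+ 2 by rewrite mulr_ge0 ?sqr_ge0// ltW.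
    lra.
  set X := Num.min _ _; set Y := _ * `|shift u 0 j - _|.
  have /andP[wi0 wi] := inv_le i ni; have /andP[wj0 wj] := inv_le j nj.
  have X0 : 0 <= X by rewrite le_min !ltW.
  have Y0 : 0 <= Y by rewrite mulr_ge0.
  have XY : n%:R * (X * Y) <= 4 * c ^+ 2 * lam.
    (* Here the minimum in the regularity condition is used. Since [2ab <= a^2 + b^2], the product
       of two shifts is controlled by the larger edge distance [M], and the minimum of the inverses
       is at most [4 / M] for the same [M]. *)
    have key M : 0 < M -> X <= 4 / M -> edge_dist u i <= M -> edge_dist u j <= M ->
        n%:R * (X * Y) <= 4 * c ^+ 2 * lam.
      move=> M0 XM iM jM; rewrite mulrCA.
      have nY0 : 0 <= n%:R * Y by rewrite mulr_ge0 ?(ltW nR).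
      apply: (le_trans (ler_pM X0 nY0 XM (prod_le M iM jM))).
      by rewrite le_eqVlt; apply/orP; left; apply/eqP; field; rewrite gt_eqF.
    have [ij|/ltW ji] := leP (edge_dist u i) (edge_dist u j).
      apply: (key (edge_dist u j)) => //; first exact: edge_dist_gt0 (shift_neq nj).
      by rewrite ge_min wj.
    apply: (key (edge_dist u i)) => //; first exact: edge_dist_gt0 (shift_neq ni).
    by rewrite ge_min wi orbT.
  rewrite /B ler_pdivlMr// (_ : K * X * Y * n%:R = K * (X * Y * n%:R)); last by ring.
  apply: (@le_trans _ _ (`|K| * (X * Y * n%:R))).
    by rewrite ler_wpM2r ?ler_norm// !mulr_ge0 ?(ltW nR).
  rewrite [X * Y * _]mulrC; apply: le_trans (ler_wpM2l (normr_ge0 K) XY) _.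
  by rewrite le_eqVlt; apply/orP; left; apply/eqP; ring.
have := ler_wpM2l (ltW nR) (copula_taylor regC Wu B0 edge01 small).
move/le_trans; apply; rewrite /B le_eqVlt; apply/orP; left; apply/eqP; field.
by rewrite gt_eqF.
Qed.

Lemma centered_hits_ones j : A (ones_but j 1) = 0.
Proof.
have i11 : 0 <= (1 : R) <= 1 by rewrite ler01 lexx.
rewrite /centered_hits (copula_ones_but j i11) mulr1.
rewrite (_ : hits _ _ = n) ?subrr// -[RHS](card_ord n); apply: eq_card => i.
rewrite !unfold_in /=; apply/mem_set; rewrite pit_box_ones_but//.
by have /andP[] := margin_cdf_itv mu j (tnth (x i) j).
Qed.

(** These terms have no Taylor counterpart and must be small by themselves: near an edge [A] is of
    order [lam], at level 1 it vanishes, and a zero shift off the edges means that [A] is 0. *)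
Lemma unshifted_margins_le u : W k u ->
  `|\sum_(j | u 0 j == shift u 0 j) pderiv C j u * A (ones_but j (u 0 j))| <=
  k%:R * (2 * c ^+ 2 * lam).
Proof.
move=> Wu; have [cu uk] := Wu.
have l0 : 0 <= 2 * c ^+ 2 * lam by rewrite !mulr_ge0 ?sqr_ge0// ltW.
apply: le_trans (ler_norm_sum _ _ _) _.
apply: (@le_trans _ _ (\sum_j (u 0 j < 1)%R%:R * (2 * c ^+ 2 * lam))); last first.
  rewrite -mulr_suml ler_wpM2r// -natr_sum ler_nat.
  by rewrite -big_mkcond sum1_card in uk *.
rewrite big_mkcond /=; apply: ler_sum => j _.
have b0 : 0 <= (u 0 j < 1)%R%:R * (2 * c ^+ 2 * lam) by rewrite mulr_ge0.
case: eqP => // e; have [u1|u1] := boolP (u 0 j < 1); last first.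
  have -> : u 0 j = 1.
    by have /andP[_] := cu j; rewrite le_eqVlt (negbTE u1) orbF => /eqP.
  by rewrite centered_hits_ones mulr0 normr0 mul0r.
rewrite normrM; apply: ler_pM => //.
  apply: pderiv_le1 => // [|u0]; first exact: copC.1.
  case: regC => reg1 _ _; apply: (reg1 j).1; split => //.
  by split => //; rewrite u0.
have [ej|ej] := boolP (near_edge u j); first exact: near_edge_deviation.
by rewrite shiftE// -e subrr mulr0 oppr0 normr0.
Qed.

Lemma linearization_error_le u : W k u ->
  Num.sqrt n%:R * `|emp_copula_process C x u - linearization mu C x u| <=
  (k%:R * (1 + c + 2 * c ^+ 2 + 2 * k%:R * c ^+ 2) + 2 * k%:R * c ^+ 2 +
   4 * `|K| * c ^+ 2 * k%:R ^+ 2 + 2 * k%:R * c ^+ 2) * rho.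
Proof.
move=> Wu; have [cu uk] := Wu.
have s0 : 0 < Num.sqrt n%:R :> R by rewrite sqrtr_gt0.
have sn0 : Num.sqrt n%:R != 0 :> R by rewrite gt_eqF.
have ss : Num.sqrt n%:R * Num.sqrt n%:R = n%:R :> R by rewrite -expr2 sqr_sqrtr// ltW.
set S := \sum_(i < n) [forall j, pseudo_obs x i 0 j <= u 0 j]%:R : R.
pose v := shift u.
pose T3 := \sum_(j | u 0 j != v 0 j) pderiv C j u * (v 0 j - u 0 j).
pose T4 := \sum_(j | u 0 j == v 0 j) pderiv C j u * A (ones_but j (u 0 j)).
have decomp : Num.sqrt n%:R * (emp_copula_process C x u - linearization mu C x u) =
    (S - (hits x (pit_box mu v))%:R) + (A v - A u) +
    n%:R * (C v - C u - T3) + T4.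
  have e1 : Num.sqrt n%:R * emp_copula_process C x u = S - n%:R * C u :> R.
    rewrite /emp_copula_process /emp_copula mulrA ss mulrBr mulrA mulfV ?mul1r//.
    by rewrite gt_eqF.
  have e2 : Num.sqrt n%:R * linearization mu C x u =
      A u - \sum_j pderiv C j u * A (ones_but j (u 0 j)).
    rewrite /linearization /std_emp_margin std_emp_processE mulrBr mulVKf//.
    congr (_ - _); rewrite mulr_sumr; apply: eq_bigr => j _.
    by rewrite std_emp_processE mulrCA mulVKf.
  (* For shifted coordinates the margin of [A] is [- n] times the shift, so their part of the
     linearization is exactly [- n] times the first-order Taylor term of [C]. *)
  have e3 : \sum_j pderiv C j u * A (ones_but j (u 0 j)) = T4 - n%:R * T3.
    rewrite (bigID (fun j => u 0 j == v 0 j)) /=; congr (_ + _).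
    rewrite mulr_sumr -sumrN; apply: eq_bigr => j /shift_neq ej.
    by rewrite shiftE// -/v; ring.
  by rewrite mulrBr e1 e2 e3 [A v]/centered_hits; ring.
rewrite -{1}(ger0_norm (ltW s0)) -normrM decomp.
have h1 := emp_copula_shift_diff Wu; rewrite -/S -/v in h1.
have h2 := shift_increment Wu.
have h3 := copula_shift_taylor Wu.
have h4 := unshifted_margins_le Wu.
apply: le_trans (ler_normD _ _) _.
apply: le_trans (lerD (ler_normD _ _) (lexx _)) _.
apply: le_trans (lerD (lerD (ler_normD _ _) (lexx _)) (lexx _)) _.
rewrite [`|n%:R * _|]normrM (ger0_norm (ltW nR)).
apply: le_trans (lerD (lerD (lerD h1 h2) h3) h4) _.
have r1 : 1 <= rho by exact: le_trans lam1 lam_rho.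
have lr := lam_rho; have c_ge0 := ltW c0; move: (rho) lr r1 => r lr r1.
have k_ge0 : 0 <= k%:R :> R by [].
have c2 := sqr_ge0 c.
have f1 := ler_wpM2l k_ge0 r1.
have f2 := ler_wpM2l (mulr_ge0 k_ge0 c_ge0) lr.
have f3 := ler_wpM2l (mulr_ge0 k_ge0 c2) lr.
have f4 := ler_wpM2l (mulr_ge0 (mulr_ge0 (normr_ge0 K) c2) (sqr_ge0 (k%:R : R))) lr.
lra.
Qed.

End linearization_error.

(** * Probability of the bad events and behaviour of the rate *)

Section asymptotics.
Context {R : realType}.

Lemma bad_event_le {dT} {T : measurableType dT} (P : probability T R)
    {d k n : nat} (mu : probability (d.-tuple R) R)
    (X : 'I_n -> {RV P >-> d.-tuple R})
    (M := (4 * k + 2)%:R : R) (lam := ln (n * d)%:R : R)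
    (nu := fun i => n%:R * fine (mu (@test_set R d mu k n i)))
    (E := [set w | exists i, (2 * M + 1) * Num.sqrt (lam * Num.max (nu i) lam) <=
              `|(hits (X ^~ w) (test_set mu i))%:R - nu i| ]) :
  (2 <= n)%N -> (0 < d)%N -> iid_with_law mu X ->
  (forall j, continuous (margin_cdf mu j)) ->
  measurable E /\ (P E <= (4 * n%:R ^- 2)%:E)%E.
Proof.
move=> n2 d0 iidX cmu.
have nd2 : (2 <= n * d)%N by rewrite (leq_trans n2)// leq_pmulr.
have nd0 : 0 < (n * d)%:R :> R by rewrite ltr0n (leq_trans _ nd2).
have lam0 : 0 < lam by rewrite ln_gt0// ltr1n.
have M0 : 0 <= M by [].
have [mE PE] := hits_family_deviation iidX (measurable_test_set (k := k) (n := n) cmu) M0 lam0.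
split=> //; apply: (le_trans PE); rewrite lee_fin.
have -> : expR (- (M * lam)) = (n * d)%:R ^- (4 * k + 2).
  by rewrite expRN /M expRM_natl lnK.
rewrite card_prod card_option card_ffun card_prod !card_ord.
set N := ((d * n.+1) ^ k)%N.
have N0 : (0 < N)%N by rewrite expn_gt0 muln_gt0 d0.
have NN : (N.+1 * N <= 2 * (n * d) ^ (4 * k))%N.
  (* Each slot of a code has [d * n.+1] values, at most [(n * d) ^ 2] because [n >= 2]; two codes of
     [k] slots give the exponent [4 * k]. *)
  have dn : (d * n.+1 <= (n * d) ^ 2)%N.
    have nn : (n.+1 <= n * n)%N by nia.
    have dd : (d <= d * d)%N by rewrite leq_pmulr.
    by rewrite -mulnn mulnACA mulnC leq_mul.
  have Nle : (N <= (n * d) ^ (2 * k))%N.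
    rewrite expnM /N; elim: (k) => // m IH; rewrite !(expnS _ m).
    exact: leq_mul.
  apply: (@leq_trans ((2 * N) * N)); first by rewrite leq_mul// mul2n -addnn -addn1 leq_add2l.
  rewrite -mulnA leq_mul// (_ : 4 * k = 2 * k + 2 * k)%N; last by lia.
  by rewrite expnD leq_mul.
have NN' : ((N.+1 * N)%:R : R) <= 2 * (n * d)%:R ^+ (4 * k).
  by rewrite -natrX -natrM ler_nat.
have nR : 0 < n%:R :> R by rewrite ltr0n (leq_trans _ n2).
have ndn : n%:R ^+ 2 <= (n * d)%:R ^+ 2 :> R.
  by rewrite lerXn2r ?nnegrE// ler_nat leq_pmulr.
move: ((n * d)%:R : R) nd0 NN' ndn => a nd0 NN' ndn.
apply: (@le_trans _ _ (2 * a ^+ (4 * k) * (2 * a ^- (4 * k + 2)))).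
  by rewrite ler_wpM2r// mulr_ge0// invr_ge0 exprn_ge0// ltW.
have -> : 2 * a ^+ (4 * k) * (2 * a ^- (4 * k + 2)) = 4 * a ^- 2.
  by rewrite exprD; field; rewrite expf_neq0 gt_eqF.
by rewrite ler_pM2l// lef_pV2 ?posrE ?exprn_gt0.
Qed.

Lemma sqrt_rate (d : nat -> nat) (n : nat) (lam := ln (n * d n)%:R : R) :
  (0 < n)%N -> 0 <= lam ->
  Num.sqrt n%:R * rate d n = Num.sqrt (lam * Num.sqrt (lam * n%:R)).
Proof.
move=> n0 lam0; have nR : 0 < n%:R :> R by rewrite ltr0n.
have n_ge0 := ltW nR; have n_neq0 : n%:R != 0 :> R by rewrite gt_eqF.
have pD (r s t : R) (y : R) : t = r + s -> t != 0 -> y `^ t = y `^ r * y `^ s.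
  by move=> -> /negbTE rs; rewrite powRD// rs.
rewrite /rate -/lam -!powR12_sqrt ?mulr_ge0 ?powR_ge0//.
rewrite !powRM ?mulr_ge0 ?powR_ge0// -!powRrM.
rewrite (pD 2^-1 (2^-1 * 2^-1) (3 / 4) lam); [|by field|by rewrite gt_eqF].
have -> : n%:R `^ 2^-1 * (n%:R `^ (- (1 / 4)) * (lam `^ 2^-1 * lam `^ (2^-1 * 2^-1))) =
    n%:R `^ 2^-1 * n%:R `^ (- (1 / 4)) * (lam `^ 2^-1 * lam `^ (2^-1 * 2^-1)).
  by rewrite mulrA.
rewrite -(pD 2^-1 (- (1 / 4)) (2^-1 * 2^-1)); [|by field|by rewrite gt_eqF].
ring.
Qed.

Lemma ln_littleo (e : R) : 0 < e ->
  \forall n \near \oo, ln n%:R <= e * n%:R `^ (1 / 3) :> R.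
Proof.
(* With [b = n ^ (1 / 6)] one has [ln n = 6 * ln b] and [n ^ (1 / 3) = b * b], so [ln b <= b] and
   [6 <= e * b] suffice. *)
move=> e0; pose a := 6 / e; have a0 : 0 < a by rewrite divr_gt0.
near=> n.
have n0 : (0 < n)%N by near: n; exact: nbhs_infty_gt.
have nR : 0 < n%:R :> R by rewrite ltr0n.
have an : a `^ 6 <= n%:R by near: n; exact: nbhs_infty_ger.
have bn : a <= n%:R `^ (1 / 6).
  have -> : a = (a `^ 6) `^ (1 / 6).
    rewrite -powRrM (_ : 6 * (1 / 6) = 1); last by field.
    by rewrite powRr1// ltW.
  by rewrite ge0_ler_powR ?nnegrE ?powR_ge0.
set b := n%:R `^ (1 / 6) in bn.
have b0 : 0 < b by exact: lt_le_trans bn.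
have -> : n%:R `^ (1 / 3) = b * b.
  rewrite /b -powRD; last by apply/implyP; rewrite gt_eqF.
  by congr (_ `^ _); field.
have -> : ln n%:R = 6 * ln b.
  by rewrite /b ln_powR mulrA; have -> : 6 * (1 / 6) = 1 :> R by [field]; rewrite mul1r.
have := ln_sublinear b0; have : 6 <= e * b.
  by move: bn; rewrite /a ler_pdivrMr// mulrC.
nra.
Unshelve. all: by end_near. Qed.

Lemma ln_mul_littleo (d : nat -> nat) : (forall n, (0 < n)%N -> (0 < d n)%N) ->
  (fun n : nat => ln (d n)%:R : R) =o_\oo (fun n : nat => n%:R `^ (1 / 3) : R) ->
  forall e, 0 < e -> \forall n \near \oo, ln (n * d n)%:R <= e * n%:R `^ (1 / 3) :> R.
Proof.
move=> d0 /eqoP od e e0.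
have e2 : 0 < e / 2 by rewrite divr_gt0.
near=> n.
have n0 : (0 < n)%N by near: n; exact: nbhs_infty_gt.
rewrite natrM lnM ?posrE ?ltr0n ?d0// [e]splitr mulrDl; apply: lerD.
  by near: n; exact: ln_littleo.
apply: le_trans (ler_norm _) _; rewrite -[leRHS](_ : e / 2 * `|n%:R `^ (1 / 3)| = _).
  by near: n; exact: od.
by rewrite ger0_norm ?powR_ge0.
Unshelve. all: by end_near. Qed.

Lemma rate_cvg0 (d : nat -> nat) : (forall n, (0 < n)%N -> (0 < d n)%N) ->
  (fun n : nat => ln (d n)%:R : R) =o_\oo (fun n : nat => n%:R `^ (1 / 3) : R) ->
  (rate d n : R) @[n --> \oo] --> 0.
Proof.
move=> d0 od; apply/cvgrPdist_le => e e0.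
(* The power [3 / 4] in [rate] turns the tolerance [e ^ (4 / 3)] on the logarithm into [e], and
   [n ^ (1 / 3)] into the factor [n ^ (1 / 4)] that cancels. *)
have e43 : 0 < e `^ (4 / 3) by rewrite powR_gt0.
near=> n.
have n0 : (0 < n)%N by near: n; exact: nbhs_infty_gt.
have nR : 0 < n%:R :> R by rewrite ltr0n.
have lam0 : 0 <= ln (n * d n)%:R :> R.
  by rewrite ln_ge0// ler1n muln_gt0 n0 d0.
rewrite sub0r normrN ger0_norm ?mulr_ge0 ?powR_ge0//.
have h : ln (n * d n)%:R <= e `^ (4 / 3) * n%:R `^ (1 / 3) :> R.
  by near: n; exact: ln_mul_littleo.
rewrite /rate; apply: (@le_trans _ _ (n%:R `^ (- (1 / 4)) *
    (e `^ (4 / 3) * n%:R `^ (1 / 3)) `^ (3 / 4))).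
  rewrite ler_wpM2l ?powR_ge0// ge0_ler_powR ?nnegrE ?mulr_ge0 ?powR_ge0//.
rewrite powRM ?powR_ge0// -!powRrM.
have -> : 4 / 3 * (3 / 4) = 1 :> R by field.
have -> : 1 / 3 * (3 / 4) = 1 / 4 :> R by field.
rewrite powRr1 ?(ltW e0)// powRN mulrCA mulVf ?mulr1//.
by rewrite gt_eqF// powR_gt0.
Unshelve. all: by end_near. Qed.

End asymptotics.

(** * The supremum and the almost sure conclusion *)

Lemma sup_error_le {R : realType} {d k n : nat} (mu : probability (d.-tuple R) R)
    (C : 'rV[R]_d -> R) (x : 'I_n -> d.-tuple R) (b : R) :
  (forall u, W k u -> `|emp_copula_process C x u - linearization mu C x u| <= b) ->
  (sup_error mu C x k <= b%:E)%E.
Proof. by move=> h; apply: ge_ereal_sup => _ [u Wu <-]; rewrite lee_fin h. Qed.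

Lemma sup_error_ge0 {R : realType} {d k n : nat} (mu : probability (d.-tuple R) R)
    (C : 'rV[R]_d -> R) (x : 'I_n -> d.-tuple R) :
  (0 <= sup_error mu C x k)%E.
Proof.
pose u : 'rV[R]_d := const_mx 1.
have Wu : W k u.
  split; first by move=> j; rewrite mxE ler01 lexx.
  by rewrite eq_card0// => j; rewrite !inE mxE ltxx.
apply: (@le_trans _ _ (`|emp_copula_process C x u - linearization mu C x u|)%:E).
  by rewrite lee_fin.
by apply: ereal_sup_ubound; exists u.
Qed.

Lemma limn_esup_le {R : realType} (f : nat -> \bar R) (c : R) :
  (\forall n \near \oo, (f n <= c%:E)%E) -> (limn_esup f <= c%:E)%E.
Proof.
move=> fc; apply: ge_ereal_inf; exists (ereal_sup (f @` [set n | (f n <= c%:E)%E])).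
  by exists [set n | (f n <= c%:E)%E].
by apply: ge_ereal_sup => _ [n /= ? <-].
Qed.

Theorem theorem2p5 (R : realType) (k : nat) (K : R) (hk : (2 <= k)%N) :
  exists c : R,
  forall (dT : measure_display) (T : measurableType dT) (P : probability T R)
    (d : nat -> nat)
    (X : forall n, 'I_n -> {RV P >-> (d n).-tuple R})
    (mu : forall n, probability ((d n).-tuple R) R)
    (C : forall n, 'rV[R]_(d n) -> R),
  (forall n, (0 < n)%N ->
    [/\ (k <= d n)%N,
        iid_with_law (mu n) (X n),
        (forall j, continuous (margin_cdf (mu n) j)),
        copula_of (mu n) (C n) &
        second_order_regular k K (C n)]) ->
  (fun n : nat => ln (d n)%:R : R) =o_\oo (fun n : nat => n%:R `^ (1 / 3) : R) ->
  let err n w := sup_error (mu n) (C n) (fun i => X n i w) k in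
  bigO_as P err (rate d) c /\ littleo1_as P err.
Proof.
have k0 : (0 < k)%N by exact: leq_trans hk.
pose M : R := (4 * k + 2)%:R.
(* [cd] is the constant of [grid_good_sample] for [2 * M + 1], and [c] below is the factor of [rho]
   in [linearization_error_le]. Both are fixed before the array is given and involve only [k] and
   [K]. *)
pose cd : R := (2 * M + 1) * (1 + 2 * k%:R) + 2 * k%:R.
pose c : R := k%:R * (1 + cd + 2 * cd ^+ 2 + 2 * k%:R * cd ^+ 2) + 2 * k%:R * cd ^+ 2 +
   4 * `|K| * cd ^+ 2 * k%:R ^+ 2 + 2 * k%:R * cd ^+ 2.
have k1 : 1 <= k%:R :> R by rewrite ler1n.
(* The exponent 4 k + 2 beats the (n d)^(4 k) test sets by a factor n^2. *)
have M0 : 0 <= M by [].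
have cd1 : 1 <= cd by rewrite /cd; nra.
exists c => dT T P d X mu C H od err.
have d0 n : (0 < n)%N -> (0 < d n)%N.
  by move=> /H[kd _ _ _ _]; exact: leq_trans kd.
pose lam n : R := ln (n * d n)%:R.
pose nu n i : R := n%:R * fine (mu n (@test_set R (d n) (mu n) k n i)).
pose E n := [set w | exists i,
  (2 * M + 1) * Num.sqrt (lam n * Num.max (nu n i) (lam n)) <=
  `|(hits ((X n) ^~ w) (test_set (mu n) i))%:R - nu n i| ].
have EP n : (2 <= n)%N -> measurable (E n) /\ (P (E n) <= (4 * n%:R ^- 2)%:E)%E.
  move=> n2; have n0 : (0 < n)%N by exact: leq_trans n2.
  have [_ iidX cmu _ _] := H n n0; apply: bad_event_le => //; exact: d0.
have rates : \forall n \near \oo, 0 < rate d n :> R.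
  near=> n.
  have n2 : (1 < n)%N by near: n; exact: nbhs_infty_gt.
  have n0 : (0 < n)%N by exact: ltnW.
  rewrite /rate mulr_gt0 ?powR_gt0 ?ltr0n// ln_gt0// ltr1n.
  by apply: leq_trans n2 _; rewrite leq_pmulr// d0.
(* The supremum is bounded pointwise outside the measurable events [E n], so its own measurability
   never comes up. *)
have key : \forall w \ae P, \forall n \near \oo, (err n w <= (c * rate d n)%:E)%E.
  have := borel_cantelli_inv_sqr (fun n n2 => (EP n n2).1) (fun n n2 => (EP n n2).2).
  apply: filterS => w [N NE].
  near=> n.
  have n2 : (1 < n)%N by near: n; exact: nbhs_infty_gt.
  have n0 : (0 < n)%N by exact: ltnW.
  have nR : 0 < n%:R :> R by rewrite ltr0n.
  have nE : ~ E n w by apply: NE; near: n; exact: nbhs_infty_ge.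
  have [kd iidX cmu copC regC] := H n n0.
  have lam1 : 1 <= lam n.
    rewrite -[leLHS]expRK ler_ln ?posrE ?expR_gt0 ?ltr0n ?muln_gt0 ?n0 ?d0//.
    apply: (@le_trans _ _ n%:R); first by near: n; exact: nbhs_infty_ger.
    by rewrite ler_nat leq_pmulr// d0.
  (* The growth condition on [d] enters with [e = 1], as [n ^ (1 / 3) <= n]; its full strength is
     used in [rate_cvg0]. *)
  have lamn : lam n <= n%:R.
    apply: (@le_trans _ _ (1 * n%:R `^ (1 / 3))).
      by near: n; exact: ln_mul_littleo.
    rewrite mul1r -[leRHS]powRr1 ?(ltW nR)//.
    by rewrite ler_powR// ?ler1n//; lra.
  have good : good_sample (mu n) (k := k) cd (lam n) ((X n) ^~ w).
    apply: grid_good_sample => //; [exact: (d0 n n0)|by rewrite addr_ge0// mulr_ge0|].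
    move=> i; rewrite leNgt; apply/negP => h; apply: nE; exists i; exact: ltW.
  apply: sup_error_le => u Wu.
  have := linearization_error_le cmu copC regC k0 n0 cd1 lam1 lamn good Wu.
  rewrite -sqrt_rate//; last exact: le_trans lam1.
  by rewrite mulrCA ler_pM2l// sqrtr_gt0.
split.
  apply: filterS key => w kw; apply: limn_esup_le; near=> n.
  have r0 : 0 < rate d n :> R by near: n.
  have kn : (err n w <= (c * rate d n)%:E)%E by near: n.
  have -> : c%:E = ((c * rate d n)%:E * ((rate d n)^-1)%:E)%E.
    by rewrite -EFinM mulfK// gt_eqF.
  by apply: lee_wpmul2r kn; rewrite lee_fin invr_ge0 ltW.
apply: filterS key => w kw.
apply: (@squeeze_cvge _ _ _ _ (fun=> 0%E) _ (fun n => (c * rate d n)%:E)).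
- near=> n; rewrite sup_error_ge0 /=; near: n; exact: kw.
- exact: cvg_cst.
- apply: cvg_EFin; first by near=> n.
  rewrite -[X in _ --> X](mulr0 c); apply: cvgMr.
  exact: rate_cvg0.
Unshelve. all: by end_near. Qed.
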